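(* Let $k>0$. Consider the four-dimensional ($\nu=3$) isotropic Euler-Poisson equations $$r^3n_t+(nur^3)_r=0,\qquad u_t+uu_r=-k\phi_r,\qquad (r^3\phi_r)_r=-nr^3,\qquad r>0,\ t>0,$$ with initial data $(n,u)(r,0)=(n_0,u_0)(r)$, $n_0\ge0$, $u_0>0$, and let $E_0(\alpha)=\alpha^{-3}\int_0^\alpha n_0(\xi)\xi^3\,d\xi$. A solution blows up in finite time if and only if $$\exists\,\alpha\in\mathbb{R}^+\quad\text{s.t.}\quad(\alpha u_0'-u_0)^2\ge4k\alpha\left(\frac{n_0\alpha}{2}-E_0\right).$$ In this case, $n(r,t)$ and $u_r(r,t)$ become infinite as $t\uparrow t_c$, where the blow-up time is given explicitly by $$t_c:=2\Big/\sup\left\{-u_0'-\frac{u_0}{\alpha}+\frac1\alpha\sqrt{(\alpha u_0'-u_0)^2-4k\alpha\left(\frac{n_0\alpha}{2}-E_0\right)}\right\},$$ the supremum being over the $\alpha\in\mathbb{R}^+$ satisfying $(\alpha u_0'-u_0)^2\ge4k\alpha\left(\frac{n_0\alpha}{2}-E_0\right)$ ($u_0,u_0',n_0,E_0$ evaluated at $\alpha$).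
   Context: Initial data: $n_0,u_0\in C^1$. With $E=-\phi_r$, it is required that $Er^3$ vanish at $r=0$, i.e. $E(r,t)\,r^3=\int_0^r n(\xi,t)\xi^3\,d\xi$. Blow-up means that $n$ and $u_r$ become unbounded along a particle path $\frac{d}{dt}r(\alpha,t)=u(r(\alpha,t),t)$, $r(\alpha,0)=\alpha$.
   Formalization: Blow-up criterion also needs the bracket in t_c positive at that α (u=r/(1+t), n=0 is global); n→∞ is claimed only where n0(α)>0; solutions are C^1, not continuable to the closed [0,T] (so an unattained sup is excluded), with n,u continuous at r=0 and u(0,t)=0. *)

(* Defs.v *)
From Stdlib Require Export Reals.
From Coquelicot Require Export Coquelicot.

Open Scope R_scope.

Definition continuous_within (D : R -> Prop) (f : R -> R) : Prop :=
  forall x, D x -> filterlim f (within D (locally x)) (locally (f x)).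

Definition continuous_within2 (D : R * R -> Prop) (f : R -> R -> R) : Prop :=
  forall p, D p ->
    filterlim (fun q => f (fst q) (snd q)) (within D (locally p))
      (locally (f (fst p) (snd p))).

(* [f] is C^1 on [0, +oo): the derivative on (0, +oo) extends continuously
   to 0; values of [f] on the negative half-line are irrelevant. *)
Definition C1_half_line (f : R -> R) : Prop :=
  continuous_within (fun x => 0 <= x) f /\
  exists g : R -> R,
    continuous_within (fun x => 0 <= x) g /\
    forall x, 0 < x -> is_derive f x (g x).

(* [f] is C^1 on (0, +oo) x J, where J is a time interval that may contain its
   endpoints: the t-derivative is taken at interior times and extends
   continuously to all of J. *)
Definition C1_in_spacetime (J : R -> Prop) (f : R -> R -> R) : Prop :=
  let D := fun p : R * R => 0 < fst p /\ J (snd p) in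
  continuous_within2 D f /\
  exists fr ft : R -> R -> R,
    continuous_within2 D fr /\ continuous_within2 D ft /\
    (forall r t, 0 < r -> J t -> is_derive (fun x => f x t) r (fr r t)) /\
    (forall r t, 0 < r -> locally t J -> is_derive (fun s => f r s) t (ft r t)).

(* Classical solutions of the initial value problem over the time interval J.
   At the centre of symmetry, n and u are continuous up to r = 0, the radial
   velocity vanishes (as it does for every continuous isotropic velocity field
   u(r,t) x/r on R^4), and r^3 phi_r vanishes as well, i.e. E r^3 does for
   E = - phi_r. *)
Record classical_solution (k : R) (n0 u0 : R -> R) (J : R -> Prop)
    (n u phi : R -> R -> R) : Prop := {
  sol_C1_n : C1_in_spacetime J n;
  sol_C1_u : C1_in_spacetime J u;
  sol_mass : forall r t, 0 < r -> locally t J ->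
    r ^ 3 * Derive (fun s => n r s) t
      + Derive (fun x => n x t * u x t * x ^ 3) r = 0;
  sol_momentum : forall r t, 0 < r -> locally t J ->
    Derive (fun s => u r s) t + u r t * Derive (fun x => u x t) r
      = - k * Derive (fun x => phi x t) r;
  sol_phi_r : forall r t, 0 < r -> J t -> ex_derive (fun x => phi x t) r;
  sol_poisson : forall r t, 0 < r -> J t ->
    is_derive (fun x => x ^ 3 * Derive (fun y => phi y t) x) r (- n r t * r ^ 3);
  sol_centre_phi : forall t, J t ->
    filterlim (fun r => r ^ 3 * Derive (fun x => phi x t) r)
      (at_right 0) (locally 0);
  sol_centre_n : continuous_within2 (fun p => 0 <= fst p /\ J (snd p)) n;
  sol_centre_u : continuous_within2 (fun p => 0 <= fst p /\ J (snd p)) u;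
  sol_centre_u0 : forall t, J t -> u 0 t = 0;
  sol_init : forall r, 0 < r -> n r 0 = n0 r /\ u r 0 = u0 r
}.

Definition before (T : Rbar) (t : R) : Prop := 0 <= t /\ Rbar_lt t T.
Definition upto (T : R) (t : R) : Prop := 0 <= t <= T.

(* A classical solution on [0, T), 0 < T <= +oo, which cannot be continued to a
   classical solution on the closed interval [0, T]. *)
Definition maximal_solution (k : R) (n0 u0 : R -> R) (T : Rbar)
    (n u phi : R -> R -> R) : Prop :=
  Rbar_lt 0 T /\
  classical_solution k n0 u0 (before T) n u phi /\
  forall T' : R, T = Finite T' ->
    ~ exists n' u' phi' : R -> R -> R,
        classical_solution k n0 u0 (upto T') n' u' phi' /\
        forall r t, 0 < r -> 0 <= t < T' -> n' r t = n r t /\ u' r t = u r t.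

Definition particle_path (u : R -> R -> R) (T : Rbar) (alpha : R)
    (x : R -> R) : Prop :=
  x 0 = alpha /\
  continuous_within (before T) x /\
  (forall t, before T t -> 0 < x t) /\
  (forall t, 0 < t -> Rbar_lt t T -> is_derive x t (u (x t) t)).

Definition unbounded_before (T : R) (f : R -> R) : Prop :=
  forall M : R, exists t : R, 0 <= t < T /\ M < Rabs (f t).

(* The proviso on n0 is needed because the data may contain vacuum: n vanishes
   identically along a particle path which starts where n0 = 0. *)
Definition blows_up (n0 : R -> R) (T : Rbar) (n u : R -> R -> R) : Prop :=
  exists tc : R, T = Finite tc /\
  exists (alpha : R) (x : R -> R),
    0 < alpha /\ particle_path u T alpha x /\
    unbounded_before tc (fun t => Derive (fun r => u r t) (x t)) /\
    (0 < n0 alpha -> unbounded_before tc (fun t => n (x t) t)).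

Definition E0 (n0 : R -> R) (alpha : R) : R :=
  / alpha ^ 3 * RInt (fun xi => n0 xi * xi ^ 3) 0 alpha.

Definition admissible (k : R) (n0 u0 : R -> R) (alpha : R) : Prop :=
  0 < alpha /\
  (alpha * Derive u0 alpha - u0 alpha) ^ 2
    >= 4 * k * alpha * (n0 alpha * alpha / 2 - E0 n0 alpha).

Definition rate (k : R) (n0 u0 : R -> R) (alpha : R) : R :=
  - Derive u0 alpha - u0 alpha / alpha
  + / alpha * sqrt ((alpha * Derive u0 alpha - u0 alpha) ^ 2
                    - 4 * k * alpha * (n0 alpha * alpha / 2 - E0 n0 alpha)).

Definition rates (k : R) (n0 u0 : R -> R) (y : R) : Prop :=
  exists alpha, admissible k n0 u0 alpha /\ y = rate k n0 u0 alpha.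

(* The condition on the initial data that is equivalent to finite time blow-up.
   With J = dr/dalpha the Jacobian of the flow,
     r J / alpha = (1 - s1 t) (1 - s2 t),   2 s1 = rate alpha,   s2 <= s1,
   with s1, s2 real exactly when alpha is admissible. The roots must moreover be
   reached at a positive time, hence 0 < rate alpha: it is not a consequence of
   admissibility, e.g. n = 0, u = r / (1 + t), phi = 0 is a global solution for
   which every alpha is admissible, with rate alpha = - 2. *)
Definition supercritical (k : R) (n0 u0 : R -> R) : Prop :=
  exists alpha, admissible k n0 u0 alpha /\ 0 < rate k n0 u0 alpha.

(* Main.v *)
Require Import Defs.
From Stdlib Require Import Reals Lra Psatz Classical.
From Coquelicot Require Import Coquelicot.
Open Scope R_scope.

(* In Lagrangian coordinates the charge e = - r^3 phi_r inside a ball is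
   transported by the flow, so the particle with label a obeys
   r'' = k e_0(a) / r^3 and r^2 = (a + u_0 t)^2 + k a E_0 t^2 explicitly. Hence
   r r_a / a is a quadratic polynomial in t whose larger reciprocal root is
   rate(a) / 2, and u_r, n blow up along a path exactly when it vanishes. A
   maximal solution cannot outlive the first root; conversely, if no root is
   reached up to time T included, the explicit formulas define a classical
   solution on [0, T]. The delicate point there is that n involves u_0', so n_r
   needs n_0 u_0'': its existence is read off from the C^1 regularity of the given
   solution at one earlier time. *)

(** * Calculus *)

(** The quadratic is special to dimension four. The repulsion [k e_0 / r^3] has the first integral
    [r'^2 + k e_0 / r^2], and [(r^2)'' = 2 (r'^2 + r r'')] is twice this constant; half the label
    derivative of [r^2] is [r r_a], again quadratic in [t]. Since [u_0 > 0] and the force points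
    outward, particles never turn back to the centre, so regularity can be lost only where [r_a]
    vanishes. Continuation up to [T] needs positivity of the quadratic at each label, with no bound
    uniform in the label: only labels in [[0, r]] can reach the radius [r], and at the label 0
    positivity is automatic. Hence a solution that stops at a finite [T] has a label whose root is
    exactly [T], and the supremum of the rates is attained there. As for [n_r], every occurrence of
    [u_0''] carries a factor [n_0]. A product is differentiable where one factor is differentiable
    and vanishes and the other is continuous; this treats vacuum and [n_0 > 0] together. *)

Section Continuity_rules.
Context {U : UniformSpace}.
Implicit Types (f g : U -> R) (x : U).

Lemma continuous_Rplus f g x :
  continuous f x -> continuous g x -> continuous (fun y => f y + g y) x.
Proof. exact (@continuous_plus U R_AbsRing R_NormedModule f g x). Qed.

Lemma continuous_Rminus f g x :
  continuous f x -> continuous g x -> continuous (fun y => f y - g y) x.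
Proof. exact (@continuous_minus U R_AbsRing R_NormedModule f g x). Qed.

Lemma continuous_Ropp f x : continuous f x -> continuous (fun y => - f y) x.
Proof. exact (@continuous_opp U R_AbsRing R_NormedModule f x). Qed.

Lemma continuous_Rmult f g x :
  continuous f x -> continuous g x -> continuous (fun y => f y * g y) x.
Proof. exact (@continuous_mult U R_AbsRing f g x). Qed.

Lemma continuous_Rinverse f x :
  continuous f x -> f x <> 0 -> continuous (fun y => / f y) x.
Proof.
intros Hf Hx. apply (continuous_comp f Rinv); trivial.
now apply continuous_Rinv.
Qed.

Lemma continuous_Rdiv f g x :
  continuous f x -> continuous g x -> g x <> 0 ->
  continuous (fun y => f y / g y) x.
Proof.
intros Hf Hg Hx. apply continuous_Rmult; trivial.
now apply continuous_Rinverse.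
Qed.

Lemma continuous_Rpow f (m : nat) x :
  continuous f x -> continuous (fun y => f y ^ m) x.
Proof.
intros Hf; induction m as [|m IH]; simpl.
- apply continuous_const.
- now apply continuous_Rmult.
Qed.

Lemma continuous_Rsqrt f x :
  continuous f x -> continuous (fun y => sqrt (f y)) x.
Proof.
intros Hf. apply (continuous_comp f sqrt); trivial. apply continuous_sqrt.
Qed.

Lemma continuous_Rcomp (h : R -> R) f x :
  continuous f x -> continuous h (f x) -> continuous (fun y => h (f y)) x.
Proof. now apply continuous_comp. Qed.
End Continuity_rules.

Lemma filterlim_Rplus {S : Type} (F : (S -> Prop) -> Prop) {FF : Filter F}
    (f g : S -> R) (a b : R) :
  filterlim f F (locally a) -> filterlim g F (locally b) ->
  filterlim (fun x => f x + g x) F (locally (a + b)).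
Proof.
intros Hf Hg. apply (filterlim_comp_2 f g Rplus Hf Hg).
exact (@filterlim_plus R_AbsRing R_NormedModule a b).
Qed.

Lemma filterlim_Rminus {S : Type} (F : (S -> Prop) -> Prop) {FF : Filter F}
    (f g : S -> R) (a b : R) :
  filterlim f F (locally a) -> filterlim g F (locally b) ->
  filterlim (fun x => f x - g x) F (locally (a - b)).
Proof.
intros Hf Hg. apply filterlim_Rplus; trivial.
apply (filterlim_comp _ _ _ g Ropp _ _ _ Hg).
exact (@filterlim_opp R_AbsRing R_NormedModule b).
Qed.

(** Clamping at 0 turns one-sided continuity in time or radius into continuity on an open set, where
    the rules above apply. *)
Lemma continuous_clamp (x : R) : continuous (fun s => Rmax 0 s) x.
Proof.
apply continuous_ext with (fun s : R => (s + Rabs s) / 2).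
- intros s. unfold Rmax, Rabs. destruct (Rle_dec 0 s), (Rcase_abs s); lra.
- apply continuous_Rdiv; [|apply continuous_const|lra].
  apply continuous_Rplus; [apply continuous_id|]. apply continuous_Rabs.
Qed.

Lemma continuous_proj1 (p : R * R) : continuous (fun q : R * R => fst q) p.
Proof. destruct p. exact (@continuous_fst R_UniformSpace R_UniformSpace _ _). Qed.

Lemma continuous_proj2 (p : R * R) : continuous (fun q : R * R => snd q) p.
Proof. destruct p. exact (@continuous_snd R_UniformSpace R_UniformSpace _ _). Qed.

Ltac cont1 :=
  match goal with
  | |- continuous (fun _ => ?c) _ => apply continuous_const
  | |- continuous (fun x => x) _ => apply continuous_id
  | |- continuous (fun x => fst x) _ => apply continuous_proj1
  | |- continuous (fun x => snd x) _ => apply continuous_proj2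
  | |- continuous fst _ => apply continuous_proj1
  | |- continuous snd _ => apply continuous_proj2
  | |- continuous (Rmax 0) _ => apply continuous_clamp
  | |- continuous (fun x => _ + _) _ => apply continuous_Rplus
  | |- continuous (fun x => _ - _) _ => apply continuous_Rminus
  | |- continuous (fun x => - _) _ => apply continuous_Ropp
  | |- continuous (fun x => _ * _) _ => apply continuous_Rmult
  | |- continuous (fun x => _ / _) _ => apply continuous_Rdiv
  | |- continuous (fun x => / _) _ => apply continuous_Rinverse
  | |- continuous (fun x => _ ^ _) _ => apply continuous_Rpow
  | |- continuous (fun x => sqrt _) _ => apply continuous_Rsqrt
  | |- continuous (fun x => Rmax 0 _) _ =>
      apply (continuous_Rcomp (Rmax 0)); [|apply continuous_clamp]
  end.
Ltac cont := repeat (cont1; simpl fst; simpl snd).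

Lemma is_derive_Rplus (f g : R -> R) (x l m : R) :
  is_derive f x l -> is_derive g x m -> is_derive (fun y => f y + g y) x (l + m).
Proof. exact (is_derive_plus f g x l m). Qed.

Lemma is_derive_Rminus (f g : R -> R) (x l m : R) :
  is_derive f x l -> is_derive g x m -> is_derive (fun y => f y - g y) x (l - m).
Proof. exact (is_derive_minus f g x l m). Qed.

Lemma is_derive_Ropp (f : R -> R) (x l : R) :
  is_derive f x l -> is_derive (fun y => - f y) x (- l).
Proof. exact (is_derive_opp f x l). Qed.

Lemma is_derive_Rmult (f g : R -> R) (x l m : R) :
  is_derive f x l -> is_derive g x m ->
  is_derive (fun y => f y * g y) x (l * g x + f x * m).
Proof.
intros Hf Hg. apply (is_derive_mult f g x l m Hf Hg).
intros a b; apply Rmult_comm.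
Qed.

Lemma is_derive_Rcomp (h f : R -> R) (x l m : R) :
  is_derive h (f x) m -> is_derive f x l -> is_derive (fun y => h (f y)) x (l * m).
Proof. exact (is_derive_comp h f x m l). Qed.

Lemma is_derive_Rdiv (f g : R -> R) (x l m : R) :
  is_derive f x l -> is_derive g x m -> g x <> 0 ->
  is_derive (fun y => f y / g y) x ((l * g x - f x * m) / g x ^ 2).
Proof. exact (is_derive_div f g x l m). Qed.

Lemma is_derive_Rpow (f : R -> R) (n : nat) (x l : R) :
  is_derive f x l -> is_derive (fun y => f y ^ n) x (INR n * l * f x ^ pred n).
Proof. exact (is_derive_pow f n x l). Qed.

Lemma is_derive_Rsqrt (f : R -> R) (x l : R) :
  is_derive f x l -> 0 < f x ->
  is_derive (fun y => sqrt (f y)) x (l / (2 * sqrt (f x))).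
Proof. exact (is_derive_sqrt f x l). Qed.

Lemma is_derive_cst (c x : R) : is_derive (fun _ => c) x 0.
Proof. exact (is_derive_const c x). Qed.

Lemma is_derive_var (x : R) : is_derive (fun y => y) x 1.
Proof. exact (is_derive_id x). Qed.

Ltac der1 :=
  match goal with
  | |- is_derive (fun _ => ?c) _ _ => apply is_derive_cst
  | |- is_derive (fun y => y) _ _ => apply is_derive_var
  | |- is_derive (fun y => _ + _) _ _ => apply is_derive_Rplus
  | |- is_derive (fun y => _ - _) _ _ => apply is_derive_Rminus
  | |- is_derive (fun y => - _) _ _ => apply is_derive_Ropp
  | |- is_derive (fun y => _ * _) _ _ => apply is_derive_Rmult
  | |- is_derive (Rmult ?c) _ _ => apply (is_derive_Rmult (fun _ => c) (fun y => y))
  | |- is_derive (fun y => _ / _) _ _ => apply is_derive_Rdiv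
  | |- is_derive (fun y => _ ^ _) _ _ => apply is_derive_Rpow
  | |- is_derive (fun y => sqrt _) _ _ => apply is_derive_Rsqrt
  | |- is_derive (fun y => exp _) _ _ => apply (is_derive_Rcomp exp); [apply is_derive_exp|]
  | H : is_derive ?f ?x _ |- is_derive ?f ?x _ => exact H
  | H : is_derive ?f ?x _ |- is_derive (fun y => ?f y) ?x _ => exact H
  end.
(** The equation left by [evar_last] lives in the carrier of an algebraic structure; [ring], [field]
    and [lra] want it over [R]. *)
Ltac req := cbv beta; cbn [pred];
  match goal with |- @eq _ ?a ?b => change (@eq R a b) end.
Ltac der := evar_last; [repeat der1|req].

Lemma continuous_is_pt (f : R -> R) (x : R) : continuous f x -> continuity_pt f x.
Proof. intros H. now apply continuity_pt_filterlim. Qed.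

Lemma is_derive_continuous (f : R -> R) (x l : R) :
  is_derive f x l -> continuous f x.
Proof. intros H. apply (ex_derive_continuous f). now exists l. Qed.

Lemma Derive_eq (f : R -> R) (x l : R) : is_derive f x l -> Derive f x = l.
Proof. exact (is_derive_unique f x l). Qed.

Lemma locally_gt (a x : R) : a < x -> locally x (fun y => a < y).
Proof. intros H. exact (open_gt a x H). Qed.

Lemma locally_lt (b x : R) : x < b -> locally x (fun y => y < b).
Proof. intros H. exact (open_lt b x H). Qed.

Lemma locally_Ioo (a b x : R) : a < x < b -> locally x (fun y => a < y < b).
Proof.
intros [H1 H2].
apply filter_and; [now apply locally_gt|now apply locally_lt].
Qed.

Lemma locally_pos {U : UniformSpace} (f : U -> R) (x : U) :
  continuous f x -> 0 < f x -> locally x (fun y => 0 < f y).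
Proof. intros H Hx. apply (H (fun y => 0 < y)). now apply locally_gt. Qed.

(** Differentiability is asked in the open interval only, because clamped functions of time may have
    a corner at 0. *)
Lemma mean_value (f df : R -> R) (a b : R) :
  a < b ->
  (forall x, a < x < b -> is_derive f x (df x)) ->
  (forall x, a <= x <= b -> continuous f x) ->
  exists c, a < c < b /\ f b - f a = df c * (b - a).
Proof.
intros Hab Hd Hc.
assert (pr1 : forall c, a < c < b -> derivable_pt f c).
{ intros c Hx. exists (df c). apply is_derive_Reals. auto. }
destruct (MVT f id a b pr1 (fun c _ => derivable_pt_id c) Hab) as (c & P & E).
- intros c Hx. apply continuous_is_pt. auto.
- intros c _. apply continuous_is_pt, continuous_id.
- exists c; split; trivial.
  rewrite (derive_pt_eq_0 _ _ _ (derivable_pt_id c) (derivable_pt_lim_id c)) in E.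
  rewrite (derive_pt_eq_0 _ _ _ (pr1 c P)
             (proj1 (is_derive_Reals _ _ _) (Hd c P))) in E.
  unfold id in E. lra.
Qed.

Lemma constant_of_derive_0 (f : R -> R) (a b : R) :
  a <= b ->
  (forall x, a < x < b -> is_derive f x 0) ->
  (forall x, a <= x <= b -> continuous f x) -> f b = f a.
Proof.
intros [Hab|Hab] Hd Hc; [|now rewrite Hab].
destruct (mean_value f (fun _ => 0) a b Hab Hd Hc) as (c & _ & E). lra.
Qed.

(** The mean value theorem makes [f] constant on the open half-line, and its limit at 0 identifies
    the constant. Conditions at the centre fix integration constants in this way. *)
Lemma zero_of_derive_0 (f : R -> R) (r : R) :
  (forall x, 0 < x -> is_derive f x 0) ->
  filterlim f (at_right 0) (locally 0) -> 0 < r -> f r = 0.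
Proof.
intros Hd Hl Hr.
assert (Hc : forall x, 0 < x <= r -> f x = f r).
{ intros x Hx. symmetry. apply constant_of_derive_0; [lra| |].
  - intros z Hz. apply Hd; lra.
  - intros z Hz. apply is_derive_continuous with 0, Hd; lra. }
apply (filterlim_locally_unique (F := at_right 0) f); trivial.
apply filterlim_ext_loc with (fun _ => f r); [|apply filterlim_const].
exists (mkposreal r Hr). intros x Hx Hx0. change (Rabs (x - 0) < r) in Hx.
rewrite Rminus_0_r, Rabs_pos_eq in Hx by lra. symmetry. apply Hc; lra.
Qed.

Lemma is_derive_RInt_upper (f : R -> R) (a b t : R) :
  (forall x, x < b -> continuous f x) -> a < b -> t < b ->
  is_derive (fun s => RInt f a s) t (f t).
Proof.
intros Hc Ha Ht.
apply is_derive_RInt with a; [|now apply Hc].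
apply filter_imp with (2 := locally_lt b t Ht).
intros s Hs. apply (@RInt_correct R_CompleteNormedModule).
apply (@ex_RInt_continuous R_CompleteNormedModule). intros z [_ Hz].
apply Hc. apply Rle_lt_trans with (1 := Hz).
unfold Rmax; destruct (Rle_dec a s); lra.
Qed.

(** Integrating factor [exp (- A)] with [A' = a]. What matters later is the sign: [y] keeps that of
    [y 0]. *)
Lemma linear_ode (a y : R -> R) (b t : R) :
  (forall x, x < b -> continuous a x) ->
  (forall x, x < b -> continuous y x) ->
  (forall x, 0 < x < b -> is_derive y x (a x * y x)) ->
  0 <= t < b -> y t = y 0 * exp (RInt a 0 t).
Proof.
intros Ha Hy Hd [Ht1 Ht2].
assert (Hb : 0 < b) by lra.
set (A := fun s => RInt a 0 s).
assert (HA : forall x, x < b -> is_derive A x (a x)).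
{ intros x Hx. now apply is_derive_RInt_upper with b. }
assert (E : y t * exp (- A t) = y 0 * exp (- A 0)).
{ apply (constant_of_derive_0 (fun s => y s * exp (- A s))); trivial.
  - intros x Hx.
    assert (H1 := Hd x ltac:(lra)). assert (H2 := HA x ltac:(lra)).
    der. simpl; ring.
  - intros x Hx. cont. apply Hy; lra.
    apply (continuous_Rcomp exp); [cont|apply continuous_exp].
    apply is_derive_continuous with (a x), HA; lra. }
assert (E0 : A 0 = 0) by (unfold A; now rewrite RInt_point).
rewrite E0, Ropp_0, exp_0, Rmult_1_r in E. rewrite <- E.
fold (A t). rewrite Rmult_assoc, <- exp_plus.
replace (- A t + A t) with 0 by ring. rewrite exp_0. ring.
Qed.

(** [V * exp (- A)], with [A' = C], cannot increase from its initial value 0. *)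
Lemma gronwall_zero (C V dV : R -> R) (b t : R) :
  (forall x, x < b -> continuous C x) ->
  (forall x, x < b -> continuous V x) ->
  (forall x, 0 < x < b -> is_derive V x (dV x) /\ dV x <= C x * V x) ->
  V 0 = 0 -> 0 <= t < b -> V t <= 0.
Proof.
intros HC HV Hd V0 [[Ht1|<-] Ht2]; [|lra].
set (A := fun s => RInt C 0 s).
assert (HA : forall x, x < b -> is_derive A x (C x)).
{ intros x Hx. apply is_derive_RInt_upper with b; trivial; lra. }
destruct (mean_value (fun s => V s * exp (- A s))
  (fun x => (dV x - C x * V x) * exp (- A x)) 0 t Ht1) as (c & Hc & E).
- intros x Hx.
  destruct (Hd x ltac:(lra)) as [H1 _]. assert (H2 := HA x ltac:(lra)).
  der. simpl; ring.
- intros x Hx. cont. apply HV; lra.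
  apply (continuous_Rcomp exp); [cont|apply continuous_exp].
  apply is_derive_continuous with (C x), HA; lra.
- destruct (Hd c ltac:(lra)) as [_ H].
  rewrite V0 in E. assert (P1 := exp_pos (- A c)). assert (P2 := exp_pos (- A t)).
  apply Rnot_lt_le; intros HVt.
  assert (0 < V t * exp (- A t)) by now apply Rmult_lt_0_compat.
  assert ((dV c - C c * V c) * exp (- A c) * (t - 0) <= 0); [|lra].
  assert ((dV c - C c * V c) * exp (- A c) <= 0) by nra. nra.
Qed.

(** Caratheodory's form of differentiability: a difference quotient continuous at [a]. It suits
    inverses, and products with a factor that is merely continuous. *)
Lemma is_derive_slope (f : R -> R) (a l : R) :
  is_derive f a l ->
  exists p, continuous p a /\ p a = l /\ forall x, f x - f a = p x * (x - a).
Proof.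
intros Hf. apply is_derive_Reals in Hf.
exists (fun x => if Req_EM_T x a then l else (f x - f a) / (x - a)).
split; [|split].
- apply continuity_pt_filterlim. intros eps Heps.
  destruct (Hf eps Heps) as [d Hd].
  exists d; split; [apply cond_pos|].
  intros x [[_ Hxa] Hx]. simpl in *. unfold Rdist in *.
  destruct (Req_EM_T a a) as [_|]; [|lra].
  destruct (Req_EM_T x a) as [->|Hne]; [lra|].
  generalize (Hd (x - a) ltac:(lra) Hx). now replace (a + (x - a)) with x by ring.
- destruct (Req_EM_T a a); lra.
- intros x. destruct (Req_EM_T x a) as [->|Hne]; [ring|]. field. lra.
Qed.

Lemma slope_is_derive (f p : R -> R) (a : R) :
  continuous p a -> locally a (fun x => f x - f a = p x * (x - a)) ->
  is_derive f a (p a).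
Proof.
intros Hp [d Hd]. apply is_derive_Reals. intros eps Heps.
destruct (proj1 (filterlim_locally _ _) Hp (mkposreal eps Heps)) as [d' Hd'].
assert (Hm : 0 < Rmin d d') by (apply Rmin_pos; apply cond_pos).
exists (mkposreal _ Hm). intros h Hh0 Hh. simpl in Hh.
assert (H1 := Rmin_l d d'). assert (H2 := Rmin_r d d').
rewrite Hd. 2: { change (Rabs (a + h - a) < d). replace (a + h - a) with h by ring. lra. }
replace (p (a + h) * (a + h - a) / h - p a) with (p (a + h) - p a) by (now field).
apply Hd'. change (Rabs (a + h - a) < d'). replace (a + h - a) with h by ring. lra.
Qed.

(** With [p] the slope function of [f] at [A x], [y - x = p (A y) * (A y - A x)] near [x], so
    [/ p (A y)] is a slope function of [A]. *)
Lemma is_derive_inverse (f A : R -> R) (x l : R) :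
  continuous A x -> locally x (fun y => f (A y) = y) ->
  is_derive f (A x) l -> l <> 0 -> is_derive A x (/ l).
Proof.
intros HA Hinv Hf Hl.
destruct (is_derive_slope _ _ _ Hf) as (p & Hp & <- & E).
assert (Hx : f (A x) = x) by now apply locally_singleton in Hinv.
assert (HpA : continuous (fun y => p (A y)) x) by now apply continuous_Rcomp.
apply (slope_is_derive A (fun y => / p (A y))).
- now apply continuous_Rinverse.
- assert (Hnz : locally x (fun y => p (A y) <> 0)).
  { apply (HpA (fun z => z <> 0)). apply open_neq; trivial. }
  apply filter_imp with (2 := filter_and _ _ Hinv Hnz).
  intros y [H1 H2]. specialize (E (A y)). rewrite H1, Hx in E. rewrite E. now field.
Qed.

(** From [f x = p x * (x - a)], [p * m] is a slope function of the product. It serves expressions in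
    [u0'], which may have no derivative. *)
Lemma is_derive_mult_vanishing (f m : R -> R) (a l : R) :
  is_derive f a l -> f a = 0 -> continuous m a ->
  is_derive (fun x => f x * m x) a (l * m a).
Proof.
intros Hf Ha Hm.
destruct (is_derive_slope _ _ _ Hf) as (p & Hp & <- & E).
apply (slope_is_derive _ (fun x => p x * m x)); [now cont|].
apply filter_forall. intros x. specialize (E x). rewrite Ha in *.
replace (f x) with (p x * (x - a)) by lra. ring.
Qed.

(** Joint differentiability at a point follows from [f_t] at that point alone, once [f_x] exists
    nearby and is continuous there. *)
Lemma is_derive_along_curve (f : R -> R -> R) (x : R -> R) (fx : R -> R -> R)
    (t ft dx : R) :
  locally (x t, t)
    (fun p : R * R => is_derive (fun z => f z (snd p)) (fst p) (fx (fst p) (snd p))) ->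
  continuous (fun p : R * R => fx (fst p) (snd p)) (x t, t) ->
  is_derive (fun s => f (x t) s) t ft ->
  is_derive x t dx ->
  is_derive (fun s => f (x s) s) t (fx (x t) t * dx + ft).
Proof.
intros H1 H2 H3 H4.
assert (H := is_derive_filterdiff f (x t) t fx ft H1 H3 H2).
assert (H5 := filterdiff_comp'_2 x (fun s => s) f t _ _
  (fun a b => plus (scal a (fx (x t) t)) (scal b ft)) H4 (filterdiff_id _) H).
apply filterdiff_ext_lin with (1 := H5).
intros y. cbn. match goal with |- ?a = ?b => change (@eq R a b) end; ring.
Qed.

(* L'Hopital's rule for f(x) / x^(m+1), in mean value form. *)
Lemma quotient_mean_value (f c : R -> R) (m : nat) (x : R) :
  0 < x -> f 0 = 0 -> (forall y, continuous f y) ->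
  (forall y, 0 < y -> is_derive f y (INR (S m) * y ^ m * c y)) ->
  exists y, 0 < y < x /\ f x / x ^ S m = c y.
Proof.
intros Hx Hf0 Hc Hd.
assert (Hxp : 0 < x ^ S m) by now apply pow_lt.
destruct (mean_value (fun y => f y * x ^ S m - f x * y ^ S m)
  (fun y => INR (S m) * y ^ m * c y * x ^ S m - f x * (INR (S m) * y ^ m)) 0 x Hx)
  as (y & Hy & E).
- intros y Hy. assert (H := Hd y (proj1 Hy)). der. ring.
- intros y _. cont. apply Hc.
- exists y; split; trivial.
  rewrite Hf0, pow_ne_zero in E by discriminate.
  assert (Hy' : 0 < y ^ m) by (apply pow_lt; lra).
  assert (Hm : 0 < INR (S m)) by (apply lt_0_INR; apply PeanoNat.Nat.lt_0_succ).
  assert (E2 : INR (S m) * y ^ m * (c y * x ^ S m - f x) * x = 0) by lra.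
  apply Rmult_integral in E2. destruct E2 as [E2|E2]; [|lra].
  apply Rmult_integral in E2. destruct E2 as [E2|E2].
  + assert (0 < INR (S m) * y ^ m) by now apply Rmult_lt_0_compat. lra.
  + replace (f x) with (c y * x ^ S m) by lra. field. lra.
Qed.

(** * One-sided continuity in space-time *)

Lemma continuous_within2_comp {U : UniformSpace} (D : R * R -> Prop)
    (f : R -> R -> R) (a b : U -> R) (x : U) :
  continuous_within2 D f -> continuous a x -> continuous b x ->
  D (a x, b x) -> locally x (fun y => D (a y, b y)) ->
  continuous (fun y => f (a y) (b y)) x.
Proof.
intros Hf Ha Hb Hx HD.
assert (Hab : filterlim (fun y => (a y, b y)) (locally x)
                (within D (locally (a x, b x)))).
{ intros P HP. unfold within in HP.
  assert (H : locally x (fun y => D (a y, b y) -> P (a y, b y))).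
  { destruct HP as [d Hd].
    apply filter_imp with (2 := filter_and _ _
      (proj1 (filterlim_locally _ _) Ha d) (proj1 (filterlim_locally _ _) Hb d)).
    intros y [H1 H2]. now apply Hd. }
  apply filter_imp with (2 := filter_and _ _ H HD). intros y [H1 H2]; auto. }
exact (filterlim_comp _ _ _ _ _ _ _ _ Hab (Hf _ Hx)).
Qed.

Lemma locally_fst (P : R -> Prop) (x y : R) :
  locally x P -> locally (x, y) (fun p : R * R => P (fst p)).
Proof. intros H. exact (@continuous_fst R_UniformSpace R_UniformSpace x y P H). Qed.

Lemma locally_snd (P : R -> Prop) (x y : R) :
  locally y P -> locally (x, y) (fun p : R * R => P (snd p)).
Proof. intros H. exact (@continuous_snd R_UniformSpace R_UniformSpace x y P H). Qed.

Lemma clamp_pos (t : R) : 0 <= t -> Rmax 0 t = t.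
Proof. apply Rmax_right. Qed.

Lemma clamp_lt (t b : R) : 0 < b -> t < b -> 0 <= Rmax 0 t < b.
Proof. intros. split; [apply Rmax_l|]. now apply Rmax_lub_lt. Qed.

Lemma clamped_continuous (b : R) (f : R -> R -> R) (r t : R) :
  continuous_within2 (fun p => 0 < fst p /\ before b (snd p)) f ->
  0 < b -> 0 < r -> t < b ->
  continuous (fun p : R * R => f (fst p) (Rmax 0 (snd p))) (r, t).
Proof.
intros Hf Hb Hr Ht.
apply (continuous_within2_comp _ f (fun p : R * R => fst p)
         (fun p : R * R => Rmax 0 (snd p)) (r, t) Hf); [cont|cont| |]; simpl.
- split; [trivial|]. now apply clamp_lt.
- apply filter_imp with (2 := filter_and _ _
    (locally_fst _ r t (locally_gt 0 r Hr)) (locally_snd _ r t (locally_lt b t Ht))).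
  intros p [H1 H2]. split; [trivial|]. now apply clamp_lt.
Qed.

Lemma clamped_continuous_centre (b : R) (f : R -> R -> R) (r t : R) :
  continuous_within2 (fun p => 0 <= fst p /\ before b (snd p)) f ->
  0 < b -> t < b ->
  continuous (fun p : R * R => f (Rmax 0 (fst p)) (Rmax 0 (snd p))) (r, t).
Proof.
intros Hf Hb Ht.
apply (continuous_within2_comp _ f (fun p : R * R => Rmax 0 (fst p))
         (fun p : R * R => Rmax 0 (snd p)) (r, t) Hf); [cont|cont| |]; simpl.
- split; [apply Rmax_l|]. now apply clamp_lt.
- apply filter_imp with (2 := locally_snd _ r t (locally_lt b t Ht)).
  intros p H2. split; [apply Rmax_l|]. now apply clamp_lt.
Qed.

Lemma continuous_slice (f : R * R -> R) (x t : R) :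
  continuous f (x, t) -> continuous (fun s => f (x, s)) t.
Proof.
intros H. apply (continuous_comp (fun s : R => (x, s)) f); [|exact H].
apply (continuous_comp_2 (fun _ : R => x) (fun s : R => s) (fun a b => (a, b))).
- apply continuous_const.
- apply continuous_id.
- apply continuous_ext with (fun p : R * R => p); [now intros []|apply continuous_id].
Qed.

(** Near the point [fx] is bounded, so [f] is Lipschitz in the first variable uniformly in the
    second, and continuity along one line suffices. It is meant for the charge, which is controlled
    in time at fixed radius. *)
Lemma continuous_of_derive_fst (f fx : R -> R -> R) (x t : R) :
  locally (x, t) (fun p : R * R => is_derive (fun z => f z (snd p)) (fst p) (fx (fst p) (snd p))) ->
  continuous (fun p : R * R => fx (fst p) (snd p)) (x, t) ->
  continuous (fun s => f x s) t ->
  continuous (fun p : R * R => f (fst p) (snd p)) (x, t).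
Proof.
intros Hd Hfx Hc.
set (K := Rabs (fx x t) + 1).
assert (HK : 0 < K) by (generalize (Rabs_pos (fx x t)); unfold K; lra).
assert (Hb : locally (x, t) (fun p : R * R => Rabs (fx (fst p) (snd p)) < K)).
{ apply (continuous_comp (fun p : R * R => fx (fst p) (snd p)) Rabs (x, t) Hfx
    (continuous_Rabs _) (fun z => z < K)). apply locally_lt. unfold K; simpl; lra. }
apply filterlim_locally. intros eps.
destruct (filter_and _ _ Hd Hb) as [d Hd'].
assert (He : 0 < eps / 2 / K).
{ apply Rdiv_lt_0_compat; [generalize (cond_pos eps); lra|trivial]. }
assert (He2 : 0 < eps / 2) by (generalize (cond_pos eps); lra).
destruct (proj1 (filterlim_locally _ _) Hc (mkposreal _ He2)) as [d2 Hd2].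
assert (Hm : 0 < Rmin (Rmin d d2) (eps / 2 / K)).
{ repeat apply Rmin_pos; trivial; apply cond_pos. }
exists (mkposreal _ Hm). intros [y s] [Hy Hs]. simpl in Hy, Hs. simpl fst; simpl snd.
assert (Hy1 : Rabs (y - x) < d).
{ eapply Rlt_le_trans; [exact Hy|]. eapply Rle_trans; [apply Rmin_l|apply Rmin_l]. }
assert (Hs1 : Rabs (s - t) < d).
{ eapply Rlt_le_trans; [exact Hs|]. eapply Rle_trans; [apply Rmin_l|apply Rmin_l]. }
assert (Hs2 : Rabs (s - t) < d2).
{ eapply Rlt_le_trans; [exact Hs|]. eapply Rle_trans; [apply Rmin_l|apply Rmin_r]. }
assert (Hy2 : Rabs (y - x) < eps / 2 / K).
{ eapply Rlt_le_trans; [exact Hy|]. apply Rmin_r. }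
assert (Hin : forall z, Rmin x y <= z <= Rmax x y ->
  is_derive (fun w => f w s) z (fx z s) /\ Rabs (fx z s) < K).
{ intros z Hz. apply (Hd' (z, s)). split; [|exact Hs1].
  change (Rabs (z - x) < d). apply Rle_lt_trans with (2 := Hy1).
  unfold Rmin, Rmax, Rabs in *.
  destruct (Rle_dec x y), (Rcase_abs (z - x)), (Rcase_abs (y - x)); lra. }
destruct (MVT_gen (fun w => f w s) x y (fun w => fx w s)) as (c & Hc1 & E).
- intros z Hz. apply Hin; lra.
- intros z Hz. apply continuous_is_pt.
  apply is_derive_continuous with (fx z s). now apply Hin.
- destruct (Hin c Hc1) as [_ HcK].
  change (Rabs (f y s - f x t) < eps).
  replace (f y s - f x t) with (fx c s * (y - x) + (f x s - f x t)) by lra.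
  eapply Rle_lt_trans; [apply Rabs_triang|]. rewrite Rabs_mult.
  assert (H1 : Rabs (fx c s) * Rabs (y - x) <= K * (eps / 2 / K)).
  { apply Rmult_le_compat; try apply Rabs_pos; lra. }
  replace (K * (eps / 2 / K)) with (eps / 2) in H1 by (field; lra).
  assert (H2 : Rabs (f x s - f x t) < eps / 2) by exact (Hd2 s Hs2).
  lra.
Qed.

(** Used to replace a possibly infinite lifespan by a real bound. *)
Lemma classical_solution_restrict (k : R) (n0 u0 : R -> R) (J J' : R -> Prop)
    (n u phi : R -> R -> R) :
  (forall t, J' t -> J t) ->
  classical_solution k n0 u0 J n u phi -> classical_solution k n0 u0 J' n u phi.
Proof.
intros HJ [Cn Cu mass mom phir poi cphi cn cu cu0 init].
assert (HJl : forall t, locally t J' -> locally t J).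
{ intros t. apply filter_imp, HJ. }
assert (W : forall (D D' : R * R -> Prop) f, (forall p, D' p -> D p) ->
  continuous_within2 D f -> continuous_within2 D' f).
{ intros D D' f HD Hf p Hp P HP.
  apply filter_imp with (2 := Hf p (HD p Hp) P HP : locally p _).
  intros q Hq Hq'. apply Hq, HD, Hq'. }
assert (C : forall f, C1_in_spacetime J f -> C1_in_spacetime J' f).
{ intros f [H0 (fr & ft & H1 & H2 & H3 & H4)].
  assert (HD : forall p : R * R, 0 < fst p /\ J' (snd p) -> 0 < fst p /\ J (snd p)).
  { intros p []; auto. }
  split; [now apply (W _ _ _ HD)|].
  exists fr, ft. split; [now apply (W _ _ _ HD)|]. split; [now apply (W _ _ _ HD)|auto]. }
assert (HD : forall p : R * R, 0 <= fst p /\ J' (snd p) -> 0 <= fst p /\ J (snd p)).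
{ intros p []; auto. }
constructor; auto; now apply (W _ _ _ HD).
Qed.

Lemma locally_before (b t : R) : 0 < t < b -> locally t (before b).
Proof.
intros H. apply filter_imp with (2 := locally_Ioo 0 b t H).
intros s Hs. split; simpl; lra.
Qed.

(* [e = - r^3 phi_r] is the charge inside the ball of radius [r]; evaluation at
   [Rmax 0 s] makes one-sided continuity at [s = 0] two-sided. *)
Record euler_flow (k b : R) (n u e nr ur : R -> R -> R) : Prop := {
  flow_cn : forall r t, 0 < r -> t < b ->
    continuous (fun p : R * R => n (fst p) (Rmax 0 (snd p))) (r, t);
  flow_cu : forall r t, 0 < r -> t < b ->
    continuous (fun p : R * R => u (fst p) (Rmax 0 (snd p))) (r, t);
  flow_cnr : forall r t, 0 < r -> t < b ->
    continuous (fun p : R * R => nr (fst p) (Rmax 0 (snd p))) (r, t);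
  flow_cur : forall r t, 0 < r -> t < b ->
    continuous (fun p : R * R => ur (fst p) (Rmax 0 (snd p))) (r, t);
  flow_ce : forall r t, 0 < r -> t < b ->
    continuous (fun p : R * R => e (fst p) (Rmax 0 (snd p))) (r, t);
  flow_nr : forall r t, 0 < r -> 0 <= t < b -> is_derive (fun x => n x t) r (nr r t);
  flow_ur : forall r t, 0 < r -> 0 <= t < b -> is_derive (fun x => u x t) r (ur r t);
  flow_er : forall r t, 0 < r -> 0 <= t < b ->
    is_derive (fun x => e x t) r (n r t * r ^ 3);
  flow_nt : forall r t, 0 < r -> 0 < t < b ->
    is_derive (fun s => n r s) t
      (- (nr r t * u r t + n r t * ur r t + 3 * n r t * u r t / r));
  flow_ut : forall r t, 0 < r -> 0 < t < b ->
    is_derive (fun s => u r s) t (- u r t * ur r t + k * e r t / r ^ 3);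
  flow_et : forall r t, 0 < r -> 0 < t < b ->
    is_derive (fun s => e r s) t (- (n r t * u r t * r ^ 3))
}.

(** * Transport of the charge *)

Lemma clamped_fun_ext_loc (b : R) (f g : R -> R -> R) (r t : R) :
  0 < r -> t < b ->
  (forall x s, 0 < x -> s < b -> f x s = g x s) ->
  locally (r, t) (fun p : R * R => f (fst p) (snd p) = g (fst p) (snd p)).
Proof.
intros Hr Ht H.
apply filter_imp with (2 := filter_and _ _
  (locally_fst _ r t (locally_gt 0 r Hr)) (locally_snd _ r t (locally_lt b t Ht))).
intros p [H1 H2]. auto.
Qed.

(* Integrating the mass equation in time and differentiating in [r] shows that
   [e(r,t) - e(r,0) + int_0^t n u r^3] does not depend on [r]; it vanishes at the
   centre. This avoids differentiating [int_0^r n x^3 dx] in time, where no bound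
   on [n_t] near the centre is available. *)
Lemma charge_flux (b : R) (n u e nr ur : R -> R -> R) :
  0 < b ->
  (forall r t, 0 < r -> t < b ->
    continuous (fun p : R * R => n (fst p) (Rmax 0 (snd p))) (r, t)) ->
  (forall r t, 0 < r -> t < b ->
    continuous (fun p : R * R => u (fst p) (Rmax 0 (snd p))) (r, t)) ->
  (forall r t, 0 < r -> t < b ->
    continuous (fun p : R * R => nr (fst p) (Rmax 0 (snd p))) (r, t)) ->
  (forall r t, 0 < r -> t < b ->
    continuous (fun p : R * R => ur (fst p) (Rmax 0 (snd p))) (r, t)) ->
  (forall r t, 0 < r -> 0 <= t < b -> is_derive (fun x => n x t) r (nr r t)) ->
  (forall r t, 0 < r -> 0 <= t < b -> is_derive (fun x => u x t) r (ur r t)) ->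
  (forall r t, 0 < r -> 0 < t < b -> is_derive (fun s => n r s) t
      (- (nr r t * u r t + n r t * ur r t + 3 * n r t * u r t / r))) ->
  (forall r t, 0 < r -> 0 <= t < b -> is_derive (fun x => e x t) r (n r t * r ^ 3)) ->
  (forall t, 0 <= t < b -> filterlim (fun r => e r t) (at_right 0) (locally 0)) ->
  (forall t, t < b ->
    continuous (fun p : R * R => n (Rmax 0 (fst p)) (Rmax 0 (snd p))) (0, t)) ->
  (forall t, t < b ->
    continuous (fun p : R * R => u (Rmax 0 (fst p)) (Rmax 0 (snd p))) (0, t)) ->
  forall r t, 0 < r -> 0 <= t < b ->
  e r t = e r 0 - RInt (fun s => n r (Rmax 0 s) * u r (Rmax 0 s) * r ^ 3) 0 t.
Proof.
intros Hb Cn Cu Cnr Cur Dn Du Dt De Ce Cn0 Cu0 r t Hr Ht.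
(* [g] is the charge flux through the sphere of radius [x], [gr] its radial derivative. *)
set (g := fun x s => n x (Rmax 0 s) * u x (Rmax 0 s) * x ^ 3).
set (gr := fun x s => (nr x (Rmax 0 s) * u x (Rmax 0 s) + n x (Rmax 0 s) * ur x (Rmax 0 s)) * x ^ 3
   + 3 * n x (Rmax 0 s) * u x (Rmax 0 s) * x ^ 2).
assert (Dg : forall x s, 0 < x -> s < b -> is_derive (fun z => g z s) x (gr x s)).
{ intros x s Hx Hs. assert (Hs' := clamp_lt s b Hb Hs).
  assert (H1 := Dn x _ Hx Hs'). assert (H2 := Du x _ Hx Hs').
  unfold g, gr. der. simpl INR. ring. }
assert (Cg : forall x s, 0 < x -> s < b -> continuous (fun p : R * R => g (fst p) (snd p)) (x, s)).
{ intros x s Hx Hs. unfold g. cont; auto. }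
assert (Cgr : forall x s, 0 < x -> s < b -> continuous (fun p : R * R => gr (fst p) (snd p)) (x, s)).
{ intros x s Hx Hs. unfold gr. cont; auto. }
assert (Cgs : forall x s, 0 < x -> s < b -> continuous (g x) s).
{ intros x s Hx Hs. exact (continuous_slice _ x s (Cg x s Hx Hs)). }
assert (Cgrs : forall x s, 0 < x -> s < b -> continuous (gr x) s).
{ intros x s Hx Hs. exact (continuous_slice _ x s (Cgr x s Hx Hs)). }
assert (Hclt : forall s, Rmin 0 t <= s <= Rmax 0 t -> s < b).
{ intros s [_ Hs]. rewrite Rmax_right in Hs; lra. }
assert (Hmass : forall x, 0 < x -> x ^ 3 * n x t - x ^ 3 * n x 0 + RInt (gr x) 0 t = 0).
{ intros x Hx.
  (* The time derivative of this sum vanishes by the mass equation. *)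
  assert (E : x ^ 3 * n x (Rmax 0 t) + RInt (gr x) 0 t = x ^ 3 * n x (Rmax 0 0) + RInt (gr x) 0 0).
  { apply (constant_of_derive_0 (fun s => x ^ 3 * n x (Rmax 0 s) + RInt (gr x) 0 s)); [lra| |].
    - intros s Hs.
      assert (H1 : is_derive (fun s => n x (Rmax 0 s)) s
        (- (nr x s * u x s + n x s * ur x s + 3 * n x s * u x s / x))).
      { apply is_derive_ext_loc with (fun s => n x s); [|apply Dt; lra].
        apply filter_imp with (2 := locally_gt 0 s (proj1 Hs)).
        intros z Hz. rewrite clamp_pos; lra. }
      assert (H2 : is_derive (fun s => RInt (gr x) 0 s) s (gr x s)).
      { apply is_derive_RInt_upper with b; try lra. intros; now apply Cgrs. }
      der. unfold gr. rewrite clamp_pos by lra. field. lra.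
    - intros s Hs. cont.
      + apply (continuous_slice (fun p => n (fst p) (Rmax 0 (snd p)))). apply Cn; lra.
      + apply is_derive_continuous with (gr x s).
        apply is_derive_RInt_upper with b; try lra. intros; now apply Cgrs. }
  rewrite RInt_point, !clamp_pos in E by lra. unfold zero in E; simpl in E. lra. }
set (F := fun x => e x t - e x 0 + RInt (g x) 0 t).
assert (DF : forall x, 0 < x -> is_derive F x 0).
{ intros x Hx.
  assert (H1 := De x t Hx Ht). assert (H2 := De x 0 Hx ltac:(lra)).
  assert (H3 : is_derive (fun x => RInt (g x) 0 t) x (RInt (gr x) 0 t)).
  { evar_last.
    - apply (is_derive_RInt_param g 0 t x).
      + apply filter_imp with (2 := locally_gt 0 x Hx). intros z Hz s Hs.
        exists (gr z s). apply Dg; auto.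
      + intros s Hs. apply continuity_2d_pt_filterlim.
        assert (E : locally (x, s) (fun p : R * R =>
          gr (fst p) (snd p) = Derive (fun z => g z (snd p)) (fst p))).
        { apply (clamped_fun_ext_loc b gr (fun x s => Derive (fun z => g z s) x)); auto.
          intros y s' Hy Hs'. symmetry. apply is_derive_unique. now apply Dg. }
        match goal with |- filterlim _ _ (locally ?l) =>
          replace l with (gr x s) by (symmetry; apply is_derive_unique, Dg; auto) end.
        apply (filterlim_ext_loc _ _ E). apply (Cgr x s); auto.
      + apply filter_imp with (2 := locally_gt 0 x Hx). intros z Hz.
        apply (@ex_RInt_continuous R_CompleteNormedModule). intros s Hs. apply Cgs; auto.
    - apply RInt_ext. intros s Hs. apply is_derive_unique, Dg; auto. apply Hclt; lra. }
  unfold F. der. generalize (Hmass x Hx). intros; lra. }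
assert (F0 : filterlim F (at_right 0) (locally 0)).
{ unfold F. replace 0 with (0 - 0 + 0) at 2 by ring.
  apply (filterlim_Rplus (at_right 0)); [apply (filterlim_Rminus (at_right 0)); apply Ce; lra|].
  (* [g] vanishes at radius 0 and is uniformly continuous along that segment of times, so it is
     below [eps / (2 * b)] at small radii; integrated over a time [t < b] it stays below [eps]. *)
  apply filterlim_locally. intros eps.
    assert (Hd : 0 < eps / (2 * b)) by (apply Rdiv_lt_0_compat; [apply cond_pos|lra]).
    destruct (uniform_continuity_2d_1d' (fun x s => g (Rmax 0 x) s) 0 t 0)
      with (eps := mkposreal _ Hd) as [d Hd'].
    + intros s Hs. apply continuity_2d_pt_filterlim.
      change (continuous (fun p : R * R => g (Rmax 0 (fst p)) (snd p)) (0, s)).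
      unfold g. cont; [apply Cn0|apply Cu0]; lra.
    + exists d. intros x Hx Hx0. change (Rabs (x - 0) < d) in Hx.
      rewrite Rminus_0_r, Rabs_pos_eq in Hx by lra.
      change (Rabs (RInt (g x) 0 t - 0) < eps). rewrite Rminus_0_r.
      apply Rle_lt_trans with ((t - 0) * (eps / (2 * b))).
      * apply abs_RInt_le_const; [lra| |].
        -- apply (@ex_RInt_continuous R_CompleteNormedModule). intros s Hs. apply Cgs; auto.
        -- intros s Hs. left.
           assert (Hlt : Rabs (g (Rmax 0 x) s - g (Rmax 0 0) s) < eps / (2 * b)).
           { apply (Hd' s 0 s x); try lra. replace (s - s) with 0 by ring.
             rewrite Rabs_R0. apply cond_pos. }
           rewrite !clamp_pos in Hlt by lra.
           replace (g 0 s) with 0 in Hlt by (unfold g; ring). now rewrite Rminus_0_r in Hlt.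
      * rewrite Rminus_0_r.
        replace (pos eps) with (b * (eps / b)) at 2 by (field; lra).
        replace (eps / (2 * b)) with (eps / b / 2) by (field; lra).
        assert (0 < eps / b) by (apply Rdiv_lt_0_compat; [apply cond_pos|lra]). nra. }
assert (E := zero_of_derive_0 F r DF F0 Hr).
unfold F in E. fold (g r). lra.
Qed.

(** Most fields are the equations solved for a time derivative. The exceptions concern the charge:
    its time derivative comes from [charge_flux], and its joint continuity from [e_r = n r^3]
    together with continuity in time at fixed radius. *)
Lemma euler_flow_of_solution (k b : R) (n0 u0 : R -> R) (n u phi : R -> R -> R) :
  0 < b -> classical_solution k n0 u0 (before b) n u phi ->
  exists nr ur, euler_flow k b n u (fun r t => - (r ^ 3 * Derive (fun x => phi x t) r)) nr ur.
Proof.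
intros Hb [Cn Cu mass mom phir poi cphi cn cu cu0 init].
destruct Cn as [Cn (nr & nt & Cnr & _ & Dn & Dnt)].
destruct Cu as [Cu (ur & ut & Cur & _ & Du & Dut)].
set (e := fun r t => - (r ^ 3 * Derive (fun x => phi x t) r)).
exists nr, ur.
assert (Hbef : forall t, 0 <= t < b -> before b t) by (intros; split; simpl; lra).
assert (Dn' : forall r t, 0 < r -> 0 <= t < b -> is_derive (fun x => n x t) r (nr r t)) by auto.
assert (Du' : forall r t, 0 < r -> 0 <= t < b -> is_derive (fun x => u x t) r (ur r t)) by auto.
assert (De : forall r t, 0 < r -> 0 <= t < b -> is_derive (fun x => e x t) r (n r t * r ^ 3)).
{ intros r t Hr Ht. evar_last.
  - apply is_derive_Ropp. apply poi; auto.
  - ring. }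
assert (Dnt' : forall r t, 0 < r -> 0 < t < b -> is_derive (fun s => n r s) t
      (- (nr r t * u r t + n r t * ur r t + 3 * n r t * u r t / r))).
{ intros r t Hr Ht. assert (HJ := locally_before b t Ht).
  assert (H1 := Dnt r t Hr HJ). evar_last; [exact H1|].
  assert (H2 := Dn' r t Hr ltac:(lra)). assert (H3 := Du' r t Hr ltac:(lra)).
  assert (H4 : is_derive (fun x => n x t * u x t * x ^ 3) r
    ((nr r t * u r t + n r t * ur r t) * r ^ 3 + n r t * u r t * (3 * r ^ 2))).
  { der. simpl INR. ring. }
  assert (E := mass r t Hr HJ).
  rewrite (Derive_eq (fun x : R => n x t * u x t * x ^ 3) _ _ H4),
    (Derive_eq (fun s : R => n r s) _ _ H1) in E.
  apply Rmult_eq_reg_l with (r ^ 3); [|apply pow_nonzero; lra].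
  replace (r ^ 3 * nt r t) with
    (- ((nr r t * u r t + n r t * ur r t) * r ^ 3 + n r t * u r t * (3 * r ^ 2))) by lra.
  field. lra. }
assert (Hflux := charge_flux b n u e nr ur Hb
  (fun r t Hr Ht => clamped_continuous b n r t Cn Hb Hr Ht)
  (fun r t Hr Ht => clamped_continuous b u r t Cu Hb Hr Ht)
  (fun r t Hr Ht => clamped_continuous b nr r t Cnr Hb Hr Ht)
  (fun r t Hr Ht => clamped_continuous b ur r t Cur Hb Hr Ht) Dn' Du' Dnt' De).
assert (Hg : forall r t, 0 < r -> t < b ->
  continuous (fun s => n r (Rmax 0 s) * u r (Rmax 0 s) * r ^ 3) t).
{ intros r t Hr Ht.
  apply (continuous_slice (fun p => n (fst p) (Rmax 0 (snd p)) * u (fst p) (Rmax 0 (snd p)) * fst p ^ 3)).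
  cont; now apply clamped_continuous with b. }
assert (HE : forall r t, 0 < r -> 0 <= t < b ->
  e r t = e r 0 - RInt (fun s => n r (Rmax 0 s) * u r (Rmax 0 s) * r ^ 3) 0 t).
{ apply Hflux.
  - intros t Ht.
    assert (H : filterlim (fun r => e r t) (at_right 0) (locally (0 - 0))).
    { apply filterlim_ext with (fun r => 0 - r ^ 3 * Derive (fun x => phi x t) r).
      - intros r. unfold e. ring.
      - apply (filterlim_Rminus (at_right 0)); [apply filterlim_const|auto]. }
    now rewrite Rminus_0_r in H.
  - intros t Ht. now apply clamped_continuous_centre with b.
  - intros t Ht. now apply clamped_continuous_centre with b. }
assert (HI : forall r t, 0 < r -> t < b -> is_derive
  (fun t => RInt (fun s => n r (Rmax 0 s) * u r (Rmax 0 s) * r ^ 3) 0 t) t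
  (n r (Rmax 0 t) * u r (Rmax 0 t) * r ^ 3)).
{ intros r t Hr Ht.
  apply (is_derive_RInt_upper (fun s => n r (Rmax 0 s) * u r (Rmax 0 s) * r ^ 3) 0 b); auto. }
constructor; trivial.
- intros; now apply clamped_continuous with b.
- intros; now apply clamped_continuous with b.
- intros; now apply clamped_continuous with b.
- intros; now apply clamped_continuous with b.
- intros r t Hr Ht.
  apply (continuous_of_derive_fst (fun x s => e x (Rmax 0 s))
           (fun x s => n x (Rmax 0 s) * x ^ 3)).
  + apply filter_imp with (2 := filter_and _ _
      (locally_fst _ r t (locally_gt 0 r Hr)) (locally_snd _ r t (locally_lt b t Ht))).
    intros [x s] [H1 H2]. apply De; trivial. now apply clamp_lt.
  + cont. now apply clamped_continuous with b.
  + apply continuous_ext_loc with (fun t => e r 0 -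
      RInt (fun s => n r (Rmax 0 s) * u r (Rmax 0 s) * r ^ 3) 0 (Rmax 0 t)).
    * apply filter_imp with (2 := locally_lt b t Ht). intros s Hs.
      symmetry; apply HE; trivial. now apply clamp_lt.
    * apply continuous_Rminus; [cont|].
      apply (continuous_Rcomp (fun t => RInt (fun s => n r (Rmax 0 s) * u r (Rmax 0 s) * r ^ 3) 0 t)
               (fun t => Rmax 0 t)); [cont|].
      refine (is_derive_continuous _ _ _ (HI r (Rmax 0 t) Hr _)). now apply clamp_lt.
- intros r t Hr Ht. assert (HJ := locally_before b t Ht).
  assert (H1 := Dut r t Hr HJ). evar_last; [exact H1|].
  assert (E := mom r t Hr HJ).
  rewrite (Derive_eq (fun s : R => u r s) _ _ H1),
    (Derive_eq (fun x : R => u x t) _ _ (Du' r t Hr ltac:(lra))) in E.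
  replace (ut r t) with (- k * Derive (fun x => phi x t) r - u r t * ur r t) by lra.
  unfold e. field. lra.
- intros r t Hr Ht.
  apply is_derive_ext_loc with (fun t => e r 0 -
    RInt (fun s => n r (Rmax 0 s) * u r (Rmax 0 s) * r ^ 3) 0 t).
  + apply filter_imp with (2 := locally_Ioo 0 b t Ht). intros s Hs.
    symmetry; apply HE; trivial; lra.
  + assert (H := HI r t Hr ltac:(lra)).
    evar_last. apply is_derive_Rminus; [apply is_derive_cst|exact H].
    rewrite clamp_pos by lra. ring.
Qed.

(** * Lagrangian data *)

Lemma continuous_within_clamp (f : R -> R) (x : R) :
  continuous_within (fun x => 0 <= x) f -> continuous (fun y => f (Rmax 0 y)) x.
Proof.
intros Hf.
assert (H : filterlim (Rmax 0) (locally x) (within (fun x => 0 <= x) (locally (Rmax 0 x)))).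
{ intros P HP. unfold within in HP.
  apply filter_imp with (2 := continuous_clamp x _ HP
    : locally x (fun y => 0 <= Rmax 0 y -> P (Rmax 0 y))).
  intros y Hy. exact (Hy (Rmax_l 0 y)). }
exact (filterlim_comp _ _ _ _ _ _ _ _ H (Hf _ (Rmax_l 0 x))).
Qed.

(** By the mean value form of L'Hopital's rule, [h x = c y] for some [y] between 0 and [x], so [h]
    tends to [c 0]. It is applied to [u0 / a] ([m = 0]) and to the charge over [a^4] ([m = 3]). *)
Lemma quotient_extension (f c : R -> R) (m : nat) :
  f 0 = 0 -> (forall x, continuous f x) -> (forall x, continuous c x) ->
  (forall x, 0 < x -> is_derive f x (INR (S m) * x ^ m * c x)) ->
  exists h, (forall x, continuous h x) /\ (forall x, x <= 0 -> h x = c 0) /\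
    forall x, 0 < x -> h x = f x / x ^ S m.
Proof.
intros Hf0 Hf Hc Hd.
set (h := fun x => if Rlt_dec 0 x then f x / x ^ S m else c 0).
assert (Hpos : forall x, 0 < x -> h x = f x / x ^ S m).
{ intros x Hx. unfold h. destruct (Rlt_dec 0 x); [trivial|lra]. }
assert (Hneg : forall x, x <= 0 -> h x = c 0).
{ intros x Hx. unfold h. destruct (Rlt_dec 0 x); [lra|trivial]. }
assert (Hmv : forall x, 0 < x -> exists y, 0 < y < x /\ h x = c y).
{ intros x Hx. rewrite Hpos by trivial. now apply quotient_mean_value. }
exists h. split; [|split]; trivial.
intros x. destruct (Rtotal_order x 0) as [Hx|[->|Hx]].
  + apply continuous_ext_loc with (fun _ => c 0); [|apply continuous_const].
    apply filter_imp with (2 := locally_lt 0 x Hx). intros y Hy.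
    symmetry. apply Hneg. lra.
  + apply filterlim_locally. intros eps. rewrite Hneg by lra.
    destruct (proj1 (filterlim_locally _ _) (Hc 0) eps) as [d Hd'].
    exists d. intros y Hy. destruct (Rle_lt_dec y 0) as [H|H].
    * rewrite Hneg by trivial. apply ball_center.
    * destruct (Hmv y H) as (w & Hw & ->). apply Hd'.
      change (Rabs (y - 0) < d) in Hy. change (Rabs (w - 0) < d).
      rewrite Rminus_0_r, Rabs_pos_eq in * by lra. lra.
  + apply continuous_ext_loc with (fun y => f y / y ^ S m).
    * apply filter_imp with (2 := locally_gt 0 x Hx). intros y Hy.
      symmetry. now apply Hpos.
    * apply continuous_Rdiv; [apply Hf|cont|]. apply pow_nonzero. lra.
Qed.

Lemma nonneg_at_0 (h : R -> R) :
  continuous h 0 -> (forall x, 0 < x -> 0 <= h x) -> 0 <= h 0.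
Proof.
intros Hc Hp. apply Rnot_lt_le. intros H.
destruct (Hc (fun z => z < 0) (locally_lt 0 (h 0) H)) as [d Hd].
assert (Hd0 := cond_pos d).
assert (h (d / 2) < 0).
{ apply Hd. change (Rabs (d / 2 - 0) < d). rewrite Rabs_pos_eq; lra. }
specialize (Hp (d / 2)). lra.
Qed.

(* For the data at the label [a]: [y = u0/a], [z = E0/a], [v = u0'], [dn = n0'],
   all extended continuously to [a <= 0]. Every Lagrangian quantity is a rational
   function of these and of [sqrt]. *)
Record profile (n dn y z v : R -> R) : Prop := {
  prof_cn : forall a, continuous n a;
  prof_cdn : forall a, continuous dn a;
  prof_cy : forall a, continuous y a;
  prof_cz : forall a, continuous z a;
  prof_cv : forall a, continuous v a;
  prof_n_ge0 : forall a, 0 <= n a;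
  prof_y_ge0 : forall a, 0 <= y a;
  prof_z_ge0 : forall a, 0 <= z a;
  prof_dn : forall a, 0 < a -> is_derive n a (dn a);
  prof_dy : forall a, 0 < a -> is_derive y a ((v a - y a) / a);
  prof_dz : forall a, 0 < a -> is_derive z a ((n a - 4 * z a) / a);
  prof_y0 : y 0 = v 0;
  prof_z0 : z 0 = n 0 / 4
}.

(** [u0 0 = 0] makes [u0 a / a] extend to the centre, with the limit of [u0'] as value;
    [E0 n0 a / a] is the charge over [a^4] and tends to [n0 0 / 4]. Hence [prof_y0] and
    [prof_z0]. *)
Lemma profile_of_data (n0 u0 : R -> R) :
  C1_half_line n0 -> C1_half_line u0 ->
  (forall r, 0 < r -> 0 <= n0 r) -> (forall r, 0 < r -> 0 < u0 r) -> u0 0 = 0 ->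
  exists n dn y z v, profile n dn y z v /\
    forall a, 0 < a -> n a = n0 a /\ v a = Derive u0 a /\ y a = u0 a / a /\
      z a = E0 n0 a / a.
Proof.
intros [Cn (gn & Cgn & Dn)] [Cu (gu & Cgu & Du)] Hn0 Hu0 Hu00.
assert (clampE : forall (f : R -> R) x, 0 < x -> f (Rmax 0 x) = f x).
{ intros f x Hx. now rewrite Rmax_right by lra. }
set (n := fun x => n0 (Rmax 0 x)). set (v := fun x => gu (Rmax 0 x)).
assert (Hn : forall x, continuous n x) by (intros; now apply continuous_within_clamp).
assert (Hv : forall x, continuous v x) by (intros; now apply continuous_within_clamp).
assert (Hw : forall x, continuous (fun y => u0 (Rmax 0 y)) x)
  by (intros; now apply continuous_within_clamp).
assert (Dw : forall x, 0 < x -> is_derive (fun y => u0 (Rmax 0 y)) x (v x)).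
{ intros x Hx. apply is_derive_ext_loc with u0.
  - apply filter_imp with (2 := locally_gt 0 x Hx). intros y Hy. now rewrite clampE.
  - unfold v. rewrite clampE by trivial. now apply Du. }
assert (nge0 : 0 <= n 0).
{ apply nonneg_at_0; [apply Hn|]. intros x Hx. unfold n. rewrite clampE; auto. }
assert (nge : forall x, 0 <= n x).
{ intros x. destruct (Rle_lt_dec x 0) as [Hx|Hx].
  - replace (n x) with (n 0); [trivial|]. unfold n. now rewrite !Rmax_left by lra.
  - unfold n. rewrite clampE; auto. }
set (ch := fun x : R => RInt (fun s => n s * s ^ 3) 0 x).
assert (Hi : forall x, continuous (fun s => n s * s ^ 3) x) by (intros; cont; apply Hn).
assert (Dch : forall x, is_derive ch x (n x * x ^ 3)).
{ intros x. apply (is_derive_RInt_upper (fun s => n s * s ^ 3) 0 (Rmax 0 x + 1) x).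
  - intros; apply Hi.
  - generalize (Rmax_l 0 x); lra.
  - generalize (Rmax_r 0 x); lra. }
destruct (quotient_extension (fun y => u0 (Rmax 0 y)) v 0) as (y & Cy & y0 & Ey); trivial.
{ now rewrite Rmax_left by lra. }
{ intros x Hx. evar_last; [now apply Dw|]. simpl; ring. }
destruct (quotient_extension ch (fun x => n x / 4) 3) as (z & Cz & z0 & Ez).
{ exact (RInt_point 0 _). }
{ intros x. apply is_derive_continuous with (1 := Dch x). }
{ intros x. cont. apply Hn. lra. }
{ intros x Hx. evar_last; [apply Dch|]. simpl INR. field. }
assert (Ey' : forall a, 0 < a -> y a = u0 a / a).
{ intros a Ha. rewrite Ey, clampE by trivial. simpl. field. lra. }
assert (yge : forall x, 0 < x -> 0 <= y x).
{ intros x Hx. rewrite Ey' by trivial. left. apply Rdiv_lt_0_compat; auto. }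
assert (zge : forall x, 0 < x -> 0 <= z x).
{ intros x Hx. rewrite Ez by trivial. apply Rdiv_le_0_compat; [|now apply pow_lt].
  apply RInt_ge_0; [lra| |].
  - apply (@ex_RInt_continuous R_CompleteNormedModule). intros; apply Hi.
  - intros s Hs. apply Rmult_le_pos; auto. apply pow_le; lra. }
exists n, (fun x => gn (Rmax 0 x)), y, z, v. split.
- constructor; trivial.
  + intros; now apply continuous_within_clamp.
  + intros a. destruct (Rle_lt_dec a 0) as [Ha|Ha]; [|auto].
    rewrite (y0 a Ha), <- (y0 0 (Rle_refl 0)). now apply nonneg_at_0.
  + intros a. destruct (Rle_lt_dec a 0) as [Ha|Ha]; [|auto].
    rewrite (z0 a Ha), <- (z0 0 (Rle_refl 0)). now apply nonneg_at_0.
  + intros a Ha. apply is_derive_ext_loc with n0.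
    * apply filter_imp with (2 := locally_gt 0 a Ha). intros x Hx.
      unfold n. now rewrite clampE.
    * rewrite clampE by trivial. now apply Dn.
  + intros a Ha. apply is_derive_ext_loc with (fun x => u0 (Rmax 0 x) / x ^ 1).
    * apply filter_imp with (2 := locally_gt 0 a Ha). intros x Hx.
      now rewrite Ey.
    * assert (H := Dw a Ha). evar_last.
      -- apply is_derive_Rdiv; [exact H|apply is_derive_Rpow, is_derive_var|].
         apply pow_nonzero; lra.
      -- rewrite Ey by trivial. cbv beta. simpl. field. lra.
  + intros a Ha. apply is_derive_ext_loc with (fun x => ch x / x ^ 4).
    * apply filter_imp with (2 := locally_gt 0 a Ha). intros x Hx.
      now rewrite Ez.
    * assert (H := Dch a). evar_last.
      -- apply is_derive_Rdiv; [exact H|apply is_derive_Rpow, is_derive_var|].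
         apply pow_nonzero; lra.
      -- rewrite Ez by trivial. cbv beta. simpl. field. lra.
  + now apply y0.
  + now apply z0.
- intros a Ha. split; [|split; [|split]].
  + unfold n. now rewrite clampE.
  + unfold v. rewrite clampE by trivial. symmetry. apply Derive_eq. now apply Du.
  + auto.
  + rewrite Ez by trivial. unfold E0, ch.
    rewrite (RInt_ext (fun s => n s * s ^ 3) (fun xi => n0 xi * xi ^ 3)).
    * field. lra.
    * intros s. rewrite Rmin_left, Rmax_right by lra. intros Hs. unfold n.
      now rewrite clampE.
Qed.

(** * Explicit characteristics *)

(* The particle with label [a] moves along [r(t) = a * sqrt (stretch2 a t)] and
   [dr/da = jac_num a t / sqrt (stretch2 a t)]. *)
Definition stretch2 (k : R) (y z : R -> R) (a t : R) : R :=
  (1 + y a * t) ^ 2 + k * z a * t ^ 2.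
Definition stretch2_t (k : R) (y z : R -> R) (a t : R) : R :=
  2 * y a * (1 + y a * t) + 2 * k * z a * t.
Definition jac_num (k : R) (n y z v : R -> R) (a t : R) : R :=
  1 + (y a + v a) * t + (y a * v a + k * (n a / 2 - z a)) * t ^ 2.
Definition jac_num_t (k : R) (n y z v : R -> R) (a t : R) : R :=
  y a + v a + 2 * (y a * v a + k * (n a / 2 - z a)) * t.
Definition position (k : R) (y z : R -> R) (a t : R) : R :=
  a * sqrt (stretch2 k y z a t).
(** The expansion rate [X_t / X], named as in cosmology; the particle velocity is [X * H]. *)
Definition hubble (k : R) (y z : R -> R) (a t : R) : R :=
  stretch2_t k y z a t / (2 * stretch2 k y z a t).

Section Lagrangian.
Context (k : R) (hk : 0 < k) (n dn y z v : R -> R) (P : profile n dn y z v).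
Notation M := (stretch2 k y z).
Notation Mt := (stretch2_t k y z).
Notation q := (jac_num k n y z v).
Notation qt := (jac_num_t k n y z v).
Notation X := (position k y z).
Notation H := (hubble k y z).

(** Outward initial velocity ([y >= 0]) and repulsion ([k * z >= 0]) only move particles away from
    the centre. For [t >= 0] this makes square roots of [M] and quotients by [M] harmless. *)
Lemma stretch2_ge1 (a t : R) : 0 <= t -> 1 <= M a t.
Proof.
intros Ht. unfold stretch2.
assert (H1 := prof_y_ge0 _ _ _ _ _ P a). assert (H2 := prof_z_ge0 _ _ _ _ _ P a).
assert (0 <= y a * t) by now apply Rmult_le_pos.
assert (0 <= k * z a * t ^ 2).
{ apply Rmult_le_pos; [apply Rmult_le_pos; lra|]. apply pow2_ge_0. }
nra.
Qed.

Lemma sqrt_stretch2_ge1 (a t : R) : 0 <= t -> 1 <= sqrt (M a t).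
Proof.
intros Ht. rewrite <- sqrt_1. apply sqrt_le_1_alt. now apply stretch2_ge1.
Qed.

Lemma sqr_sqrt_stretch2 (a t : R) : 0 <= t -> sqrt (M a t) ^ 2 = M a t.
Proof. intros Ht. apply pow2_sqrt. generalize (stretch2_ge1 a t Ht). lra. Qed.

Lemma position_ge (a t : R) : 0 <= a -> 0 <= t -> a <= X a t.
Proof.
intros Ha Ht. generalize (sqrt_stretch2_ge1 a t Ht). unfold position. nra.
Qed.

Lemma position_init (a : R) : X a 0 = a.
Proof.
unfold position, stretch2.
replace ((1 + y a * 0) ^ 2 + k * z a * 0 ^ 2) with 1 by ring.
rewrite sqrt_1. ring.
Qed.

(** Since [X^2 = a^2 M], half its label derivative is [a q] with [q = M + a M_a / 2]: this is the
    origin of [jac_num]. *)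
Lemma is_derive_stretch2_label (a t : R) : 0 < a ->
  is_derive (fun x => M x t) a (2 * (q a t - M a t) / a).
Proof.
intros Ha. assert (H1 := prof_dy _ _ _ _ _ P a Ha).
assert (H2 := prof_dz _ _ _ _ _ P a Ha).
unfold stretch2. der. simpl INR. unfold jac_num. field. lra.
Qed.

Lemma is_derive_stretch2 (a t : R) : is_derive (M a) t (Mt a t).
Proof. unfold stretch2. der. simpl INR. unfold stretch2_t. ring. Qed.

Lemma is_derive_stretch2_t_label (a t : R) : 0 < a ->
  is_derive (fun x => Mt x t) a (2 * (qt a t - Mt a t) / a).
Proof.
intros Ha. assert (H1 := prof_dy _ _ _ _ _ P a Ha).
assert (H2 := prof_dz _ _ _ _ _ P a Ha).
unfold stretch2_t. der. unfold jac_num_t. field. lra.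
Qed.

Lemma is_derive_stretch2_t (a t : R) :
  is_derive (Mt a) t (2 * (y a ^ 2 + k * z a)).
Proof. unfold stretch2_t. der. ring. Qed.

Lemma is_derive_jac_num (a t : R) : is_derive (q a) t (qt a t).
Proof. unfold jac_num. der. simpl INR. unfold jac_num_t. ring. Qed.

Lemma is_derive_position_label (a t : R) : 0 < a -> 0 <= t ->
  is_derive (fun x => X x t) a (q a t / sqrt (M a t)).
Proof.
intros Ha Ht. assert (H1 := is_derive_stretch2_label a t Ha).
assert (H2 := sqrt_stretch2_ge1 a t Ht). assert (H3 := sqr_sqrt_stretch2 a t Ht).
unfold position. der.
- generalize (stretch2_ge1 a t Ht); lra.
(* [M] becomes [w ^ 2], so that [field] meets a rational function of [w]. *)
- set (w := sqrt _) in *. rewrite <- H3. field. lra.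
Qed.

Lemma is_derive_position (a t : R) : 0 <= t ->
  is_derive (X a) t (X a t * H a t).
Proof.
intros Ht. assert (H1 := is_derive_stretch2 a t).
assert (H2 := sqrt_stretch2_ge1 a t Ht). assert (H3 := sqr_sqrt_stretch2 a t Ht).
unfold position. der.
- generalize (stretch2_ge1 a t Ht); lra.
- unfold hubble. set (w := sqrt _) in *. rewrite <- H3. field. lra.
Qed.

Lemma is_derive_velocity (a t : R) : 0 < a -> 0 <= t ->
  is_derive (fun s => X a s * H a s) t (k * (a ^ 4 * z a) / X a t ^ 3).
Proof.
intros Ha Ht. assert (H1 := is_derive_stretch2 a t).
assert (H4 := is_derive_stretch2_t a t).
assert (H5 := is_derive_position a t Ht).
assert (H2 := sqrt_stretch2_ge1 a t Ht). assert (H3 := sqr_sqrt_stretch2 a t Ht).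
assert (HM := stretch2_ge1 a t Ht).
(* Conservation of energy: multiplied by [a^2 / (4 M)], it says that [X_t^2 + k a^4 z / X^2] keeps
   the value [a^2 (y^2 + k z)]. *)
assert (EM : 2 * M a t * (2 * (y a ^ 2 + k * z a)) = Mt a t ^ 2 + 4 * k * z a).
{ unfold stretch2, stretch2_t. ring. }
unfold hubble at 1. der.
- lra.
- replace (2 * (y a ^ 2 + k * z a)) with ((Mt a t ^ 2 + 4 * k * z a) / (2 * M a t))
    by (rewrite <- EM; field; lra).
  unfold hubble, position. set (w := sqrt _) in *. rewrite <- H3. field. lra.
Qed.

Lemma is_derive_velocity_label (a t : R) : 0 < a -> 0 <= t ->
  is_derive (fun x => X x t * H x t) a ((qt a t - q a t * H a t) / sqrt (M a t)).
Proof.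
intros Ha Ht. assert (H1 := is_derive_stretch2_label a t Ha).
assert (H4 := is_derive_stretch2_t_label a t Ha).
assert (H5 := is_derive_position_label a t Ha Ht).
assert (H2 := sqrt_stretch2_ge1 a t Ht). assert (H3 := sqr_sqrt_stretch2 a t Ht).
assert (HM := stretch2_ge1 a t Ht).
unfold hubble at 1. der.
- lra.
- unfold hubble, position. set (w := sqrt _) in *. rewrite <- H3. field. lra.
Qed.

Lemma continuous_comp_everywhere (f : R -> R) {U : UniformSpace} (g : U -> R) (x : U) :
  (forall a, continuous f a) -> continuous g x -> continuous (fun p => f (g p)) x.
Proof. intros Hf Hg. now apply continuous_Rcomp. Qed.

Section Continuity.
Context {U : UniformSpace} (f g : U -> R) (x : U)
  (Hf : continuous f x) (Hg : continuous g x).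

Lemma continuous_stretch2 : continuous (fun p => M (f p) (g p)) x.
Proof.
unfold stretch2. cont; trivial; apply continuous_comp_everywhere; trivial; apply P.
Qed.

Lemma continuous_stretch2_t : continuous (fun p => Mt (f p) (g p)) x.
Proof.
unfold stretch2_t. cont; trivial; apply continuous_comp_everywhere; trivial; apply P.
Qed.

Lemma continuous_jac_num : continuous (fun p => q (f p) (g p)) x.
Proof.
unfold jac_num. cont; trivial; try apply continuous_comp_everywhere; trivial; try apply P; lra.
Qed.

Lemma continuous_jac_num_t : continuous (fun p => qt (f p) (g p)) x.
Proof.
unfold jac_num_t. cont; trivial; try apply continuous_comp_everywhere; trivial; try apply P; lra.
Qed.

Lemma continuous_position : continuous (fun p => X (f p) (g p)) x.
Proof.
unfold position. apply continuous_Rmult; trivial.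
apply continuous_Rsqrt, continuous_stretch2.
Qed.

Lemma continuous_hubble : 0 <= g x -> continuous (fun p => H (f p) (g p)) x.
Proof.
intros Ht. assert (HM := stretch2_ge1 (f x) (g x) Ht).
unfold hubble. apply continuous_Rdiv; [apply continuous_stretch2_t| |lra].
apply continuous_Rmult; [apply continuous_const|apply continuous_stretch2].
Qed.
End Continuity.
End Lagrangian.

(** * Solutions along the characteristics *)

Section Agreement.
Context (k : R) (hk : 0 < k) (n dn y z v : R -> R) (P : profile n dn y z v).
Context (b : R) (N U E NR UR : R -> R -> R)
  (F : euler_flow k b N U E NR UR).
Context (hU : forall a, 0 < a -> U a 0 = a * y a)
  (hE : forall a, 0 < a -> E a 0 = a ^ 4 * z a).
Notation M := (stretch2 k y z).
Notation q := (jac_num k n y z v).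
Notation qt := (jac_num_t k n y z v).
Notation X := (position k y z).
Notation H := (hubble k y z).

Lemma unclamp_continuous (f : R -> R -> R) (r t : R) : 0 < t ->
  continuous (fun p : R * R => f (fst p) (Rmax 0 (snd p))) (r, t) ->
  continuous (fun p : R * R => f (fst p) (snd p)) (r, t).
Proof.
intros Ht. apply continuous_ext_loc.
apply filter_imp with (2 := locally_snd _ r t (locally_gt 0 t Ht)).
intros p Hp. rewrite clamp_pos; lra.
Qed.

Lemma continuous_on_path (f : R -> R -> R) (a s : R) : 0 < a -> s < b ->
  (forall r t, 0 < r -> t < b ->
    continuous (fun p : R * R => f (fst p) (Rmax 0 (snd p))) (r, t)) ->
  continuous (fun s => f (X a (Rmax 0 s)) (Rmax 0 s)) s.
Proof.
intros Ha Hs Hf.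
apply (continuous_comp_2 (fun s => X a (Rmax 0 s)) (fun s => s)
         (fun r t => f r (Rmax 0 t)) s).
- apply (continuous_position k n dn y z v P); cont.
- cont.
- apply Hf; trivial. generalize (position_ge k hk n dn y z v P a (Rmax 0 s)).
  intros G; specialize (G ltac:(lra) (Rmax_l 0 s)). lra.
Qed.

Lemma locally_quadrant (r t : R) : 0 < r -> 0 < t < b ->
  locally (r, t) (fun p : R * R => 0 < fst p /\ 0 < snd p < b).
Proof.
intros Hr Ht. apply filter_and.
- exact (locally_fst _ r t (locally_gt 0 r Hr)).
- exact (locally_snd _ r t (locally_Ioo 0 b t Ht)).
Qed.

(* The residuals [w = U(X,t) - X_t] and [d = E(X,t) - E(a,0)] along the explicit
   curve satisfy a homogeneous linear system, so the curve is a particle path. *)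
Lemma flow_on_path (a t : R) : 0 < a -> 0 <= t < b ->
  U (X a t) t = X a t * H a t /\ E (X a t) t = a ^ 4 * z a.
Proof.
intros Ha Ht.
assert (Xpos : forall s, 0 <= s -> 0 < X a s).
{ intros s Hs. generalize (position_ge k hk n dn y z v P a s). lra. }
set (w := fun s => U (X a s) s - X a s * H a s).
set (d := fun s => E (X a s) s - a ^ 4 * z a).
(* [w'] compares the momentum equation at [X] with Newton's equation for [X]; in [d'] the charge is
   transported by [U] but followed along [X], which leaves a multiple of [w]. *)
set (w' := fun s => - UR (X a s) s * w s + k * d s / X a s ^ 3).
set (d' := fun s => - (N (X a s) s * X a s ^ 3) * w s).
assert (Dw : forall s, 0 < s < b -> is_derive w s (w' s)).
{ intros s Hs. assert (Hp := Xpos s ltac:(lra)).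
  assert (H1 := is_derive_position k hk n dn y z v P a s ltac:(lra)).
  assert (H2 : is_derive (fun s => U (X a s) s) s
     (UR (X a s) s * (X a s * H a s) + (- U (X a s) s * UR (X a s) s + k * E (X a s) s / X a s ^ 3))).
  { apply (is_derive_along_curve U (X a) UR); trivial.
    - apply filter_imp with (2 := locally_quadrant _ _ Hp Hs).
      intros p [G1 G2]. apply (flow_ur _ _ _ _ _ _ _ F); lra.
    - apply unclamp_continuous; [lra|]. apply (flow_cur _ _ _ _ _ _ _ F); lra.
    - now apply (flow_ut _ _ _ _ _ _ _ F). }
  evar_last.
  - apply is_derive_Rminus; [exact H2|].
    apply (is_derive_velocity k hk n dn y z v P a s Ha); lra.
  - unfold w', w, d. field. lra. }
assert (Dd : forall s, 0 < s < b -> is_derive d s (d' s)).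
{ intros s Hs. assert (Hp := Xpos s ltac:(lra)).
  assert (H1 := is_derive_position k hk n dn y z v P a s ltac:(lra)).
  assert (H2 : is_derive (fun s => E (X a s) s) s
     (N (X a s) s * X a s ^ 3 * (X a s * H a s) + - (N (X a s) s * U (X a s) s * X a s ^ 3))).
  { apply (is_derive_along_curve E (X a) (fun r t => N r t * r ^ 3)); trivial.
    - apply filter_imp with (2 := locally_quadrant _ _ Hp Hs).
      intros p [G1 G2]. apply (flow_er _ _ _ _ _ _ _ F); lra.
    - apply (unclamp_continuous (fun r t => N r t * r ^ 3)); [lra|].
      cont. apply (flow_cn _ _ _ _ _ _ _ F); lra.
    - now apply (flow_et _ _ _ _ _ _ _ F). }
  evar_last.
  - apply is_derive_Rminus; [exact H2|apply is_derive_cst].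
  - unfold d', w. ring. }
assert (Cpos : forall s, continuous (fun s => X a (Rmax 0 s)) s).
{ intros s. apply (continuous_position k n dn y z v P); cont. }
set (V := fun s => w (Rmax 0 s) ^ 2 + d (Rmax 0 s) ^ 2).
(* With [A = UR], [B = N], [c = X^3] and [g = k / c], [V' = - 2 A w^2 + 2 g w d - 2 B c w d]. The
   bounds are [- 2 A <= 2 (1 + A^2)], [2 w d <= w^2 + d^2] and [- 2 B w d <= (1 + B^2) (w^2 + d^2)];
   squares instead of absolute values keep [C] plainly continuous. *)
set (C := fun s => 2 * (1 + UR (X a (Rmax 0 s)) (Rmax 0 s) ^ 2) + k / X a (Rmax 0 s) ^ 3
   + (1 + N (X a (Rmax 0 s)) (Rmax 0 s) ^ 2) * X a (Rmax 0 s) ^ 3).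
assert (HV : V t <= 0).
{ apply (gronwall_zero C V (fun s => 2 * w s * w' s + 2 * d s * d' s) b); trivial.
  - intros s Hs. unfold C. cont; try apply Cpos.
    + apply continuous_on_path; trivial. apply F.
    + apply pow_nonzero, Rgt_not_eq, Xpos, Rmax_l.
    + apply continuous_on_path; trivial. apply F.
  - intros s Hs. unfold V, w, d. cont; try apply Cpos.
    + apply continuous_on_path; trivial. apply F.
    + apply (continuous_hubble k hk n dn y z v P (fun _ => a) (Rmax 0)); cont. apply Rmax_l.
    + apply (continuous_on_path E); trivial. apply F.
  - intros s Hs. assert (Hp := Xpos s ltac:(lra)).
    assert (H1 := Dw s Hs). assert (H2 := Dd s Hs). split.
    + apply is_derive_ext_loc with (fun s => w s ^ 2 + d s ^ 2).
      * apply filter_imp with (2 := locally_gt 0 s (proj1 Hs)). intros s' Hs'.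
        unfold V. now rewrite clamp_pos by lra.
      * der. simpl INR. ring.
    + unfold V, C. rewrite clamp_pos by lra. unfold w', d'.
      assert (Hp3 : 0 < X a s ^ 3) by now apply pow_lt.
      assert (Hk3 : 0 < k / X a s ^ 3) by now apply Rdiv_lt_0_compat.
      replace (k * d s / X a s ^ 3) with (k / X a s ^ 3 * d s) by (field; lra).
      generalize (UR (X a s) s) (N (X a s) s) (w s) (d s). intros A B w0 d0.
      revert Hp3 Hk3. generalize (X a s ^ 3) (k / X a s ^ 3). intros c g Hc Hg.
      assert (I1 : - 2 * A * w0 ^ 2 <= 2 * (1 + A ^ 2) * w0 ^ 2).
      { assert (0 <= w0 ^ 2) by apply pow2_ge_0. assert (0 <= (1 + A) ^ 2) by apply pow2_ge_0. nra. }
      assert (I2 : 2 * g * (w0 * d0) <= g * (w0 ^ 2 + d0 ^ 2)).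
      { assert (0 <= (w0 - d0) ^ 2) by apply pow2_ge_0. nra. }
      assert (I3 : - 2 * B * (w0 * d0) <= (1 + B ^ 2) * (w0 ^ 2 + d0 ^ 2)).
      { assert (G1 : 0 <= (w0 + B * d0) ^ 2) by apply pow2_ge_0.
        assert (G2 : 0 <= w0 ^ 2) by apply pow2_ge_0.
        assert (G3 : 0 <= d0 ^ 2) by apply pow2_ge_0.
        assert (G4 : 0 <= (B * w0) ^ 2) by apply pow2_ge_0. nra. }
      assert (I4 : c * (- 2 * B * (w0 * d0)) <= c * ((1 + B ^ 2) * (w0 ^ 2 + d0 ^ 2))).
      { apply Rmult_le_compat_l; lra. }
      assert (I5 : 0 <= (1 + A ^ 2) * d0 ^ 2).
      { apply Rmult_le_pos; [generalize (pow2_ge_0 A); lra|apply pow2_ge_0]. }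
      lra.
  - unfold V, w, d. rewrite clamp_pos by lra. rewrite (position_init k y z).
    rewrite hU, hE by trivial. unfold hubble, stretch2, stretch2_t. field. }
unfold V in HV. rewrite clamp_pos in HV by lra. unfold w, d in HV.
generalize (pow2_ge_0 (U (X a t) t - X a t * H a t)) (pow2_ge_0 (E (X a t) t - a ^ 4 * z a)).
intros G1 G2.
split; apply Rminus_diag_uniq; apply Rsqr_0_uniq; rewrite Rsqr_pow2; lra.
Qed.

(** The identities of [flow_on_path] differentiated in the label. The second is conservation of
    mass, [n r^3 r_a = n0 a^3]. There is no division by [q], because [q > 0] is itself deduced from
    the first identity. *)
Lemma flow_gradient (a t : R) : 0 < a -> 0 <= t < b ->
  UR (X a t) t * q a t = qt a t - q a t * H a t /\
  N (X a t) t * (M a t * q a t) = n a.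
Proof.
intros Ha Ht.
assert (HX : 0 < X a t) by (generalize (position_ge k hk n dn y z v P a t); lra).
assert (H1 := is_derive_position_label k hk n dn y z v P a t Ha (proj1 Ht)).
assert (Hs := sqrt_stretch2_ge1 k hk n dn y z v P a t (proj1 Ht)).
assert (Hs2 := sqr_sqrt_stretch2 k hk n dn y z v P a t (proj1 Ht)).
split.
- assert (E1 : q a t / sqrt (M a t) * UR (X a t) t = (qt a t - q a t * H a t) / sqrt (M a t)).
  { transitivity (Derive (fun x => U (X x t) t) a); [symmetry|]; apply Derive_eq.
    - apply (is_derive_Rcomp (fun r => U r t) (fun x => X x t)); trivial.
      now apply (flow_ur _ _ _ _ _ _ _ F).
    - apply is_derive_ext_loc with (fun x => X x t * H x t).
      + apply filter_imp with (2 := locally_gt 0 a Ha). intros x Hx.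
        symmetry. now apply flow_on_path.
      + apply (is_derive_velocity_label k hk n dn y z v P a t Ha); lra. }
  apply Rmult_eq_reg_r with (/ sqrt (M a t)); [|apply Rinv_neq_0_compat; lra].
  unfold Rdiv in E1. lra.
- assert (E1 : q a t / sqrt (M a t) * (N (X a t) t * X a t ^ 3) = a ^ 3 * n a).
  { transitivity (Derive (fun x => E (X x t) t) a); [symmetry|]; apply Derive_eq.
    - apply (is_derive_Rcomp (fun r => E r t) (fun x => X x t)); trivial.
      now apply (flow_er _ _ _ _ _ _ _ F).
    - apply is_derive_ext_loc with (fun x => x ^ 4 * z x).
      + apply filter_imp with (2 := locally_gt 0 a Ha). intros x Hx.
        symmetry. now apply flow_on_path.
      + assert (H2 := prof_dz _ _ _ _ _ P a Ha). der. simpl INR. field. lra. }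
  apply Rmult_eq_reg_l with (a ^ 3); [|apply pow_nonzero; lra].
  rewrite <- E1. unfold position. set (w := sqrt _) in *. rewrite <- Hs2. field. lra.
Qed.

(** By [flow_gradient], [q_t = (U_r + H) q], with [q = 1] at time 0; the coefficient is continuous
    as long as the solution lives, so [q] cannot reach 0. *)
Lemma flow_jac_pos (a t : R) : 0 < a -> 0 <= t < b -> 0 < q a t.
Proof.
intros Ha Ht.
assert (E1 : q a (Rmax 0 t) = q a (Rmax 0 0) * exp
  (RInt (fun s => UR (X a (Rmax 0 s)) (Rmax 0 s) + H a (Rmax 0 s)) 0 t)).
{ apply (linear_ode (fun s => UR (X a (Rmax 0 s)) (Rmax 0 s) + H a (Rmax 0 s))
    (fun s => q a (Rmax 0 s)) b); trivial.
  - intros s Hs. apply continuous_Rplus.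
    + apply continuous_on_path; trivial. apply F.
    + apply (continuous_hubble k hk n dn y z v P (fun _ => a) (Rmax 0)); cont. apply Rmax_l.
  - intros s Hs. apply (continuous_jac_num k n dn y z v P (fun _ => a) (Rmax 0)); cont.
  - intros s Hs. apply is_derive_ext_loc with (q a).
    + apply filter_imp with (2 := locally_gt 0 s (proj1 Hs)). intros x Hx.
      now rewrite clamp_pos by lra.
    + evar_last; [apply is_derive_jac_num|]. rewrite clamp_pos by lra.
      destruct (flow_gradient a s Ha) as [G _]; lra. }
rewrite !clamp_pos in E1 by lra. rewrite E1.
apply Rmult_lt_0_compat; [|apply exp_pos]. unfold jac_num. lra.
Qed.
End Agreement.

(** * Regularity of the density *)

Section Regularity.
Context (k : R) (hk : 0 < k) (n dn y z v : R -> R) (P : profile n dn y z v).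
Notation M := (stretch2 k y z).
Notation q := (jac_num k n y z v).
Notation X := (position k y z).

(** [q] is affine in [v = u0'], the one ingredient that may lack a derivative; [jac_const] and
    [jac_slope] are its coefficients, and the suffix [_a] marks label derivatives. *)
Definition jac_const (a t : R) : R := 1 + y a * t + k * (n a / 2 - z a) * t ^ 2.
Definition jac_slope (a t : R) : R := t + y a * t ^ 2.
Definition jac_const_a (a t : R) : R :=
  (v a - y a) / a * t + k * (dn a / 2 - (n a - 4 * z a) / a) * t ^ 2.
Definition jac_slope_a (a t : R) : R := (v a - y a) / a * t ^ 2.

Lemma jac_num_affine (a t : R) : q a t = jac_const a t + v a * jac_slope a t.
Proof. unfold jac_num, jac_const, jac_slope. ring. Qed.

Lemma is_derive_jac_const (a t : R) : 0 < a ->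
  is_derive (fun x => jac_const x t) a (jac_const_a a t).
Proof.
intros Ha. assert (H1 := prof_dy _ _ _ _ _ P a Ha).
assert (H2 := prof_dz _ _ _ _ _ P a Ha). assert (H3 := prof_dn _ _ _ _ _ P a Ha).
unfold jac_const. der; [lra|]. unfold jac_const_a. field. lra.
Qed.

Lemma is_derive_jac_slope (a t : R) : 0 < a ->
  is_derive (fun x => jac_slope x t) a (jac_slope_a a t).
Proof.
intros Ha. assert (H1 := prof_dy _ _ _ _ _ P a Ha).
unfold jac_slope. der. unfold jac_slope_a. ring.
Qed.

Section Continuity.
Context {U : UniformSpace} (f g : U -> R) (x : U)
  (Hf : continuous f x) (Hg : continuous g x) (Hpos : f x <> 0).

Lemma continuous_jac_const : continuous (fun p => jac_const (f p) (g p)) x.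
Proof.
unfold jac_const. cont; trivial; try apply continuous_comp_everywhere; trivial; try apply P; lra.
Qed.

Lemma continuous_jac_slope : continuous (fun p => jac_slope (f p) (g p)) x.
Proof.
unfold jac_slope. cont; trivial; try apply continuous_comp_everywhere; trivial; try apply P.
Qed.

Lemma continuous_jac_const_a : continuous (fun p => jac_const_a (f p) (g p)) x.
Proof.
unfold jac_const_a. cont; trivial; try apply continuous_comp_everywhere; trivial; try apply P; lra.
Qed.

Lemma continuous_jac_slope_a : continuous (fun p => jac_slope_a (f p) (g p)) x.
Proof.
unfold jac_slope_a. cont; trivial; try apply continuous_comp_everywhere; trivial; try apply P; lra.
Qed.
End Continuity.

(* The density depends on [u0'], which is merely continuous. If it is C^1 at one
   positive time, then [n0 u0''] exists in the sense below; this is the only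
   combination involving [u0''] that enters [n_r] at any other time. *)
Lemma weighted_second_derivative (b : R) (N U E NR UR : R -> R -> R) (s : R) :
  euler_flow k b N U E NR UR -> 0 < b ->
  (forall a, 0 < a -> U a 0 = a * y a) -> (forall a, 0 < a -> E a 0 = a ^ 4 * z a) ->
  0 < s < b ->
  exists w, forall a, 0 < a -> continuous w a /\ is_derive (fun x => n a * v x) a (w a).
Proof.
intros F Hb HU HE Hs.
(* [G] is the density at time [s] as a function of the label and [K] the volume ratio, so
   [G * K = n]; [kap a] will be the derivative at [a] of [n a * K x]. *)
set (G := fun x => N (X x s) s).
set (G' := fun x => q x s / sqrt (M x s) * NR (X x s) s).
set (K := fun x => M x s * q x s).
set (M' := fun x => 2 * (q x s - M x s) / x).
set (kap := fun x => K x * (dn x - G' x * K x)).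
set (num' := fun x => (kap x * M x s - n x * K x * M' x) / M x s ^ 2 - n x * jac_const_a x s).
assert (HX : forall a, 0 < a -> 0 < X a s).
{ intros a Ha. generalize (position_ge k hk n dn y z v P a s). lra. }
assert (HM : forall a, 1 <= M a s).
{ intros a. apply (stretch2_ge1 k hk n dn y z v P). lra. }
(* Positive because [s > 0]; at time 0 the Jacobian is 1 and says nothing about [v]. *)
assert (Hsl : forall a, 0 < jac_slope a s).
{ intros a. assert (H1 := prof_y_ge0 _ _ _ _ _ P a). unfold jac_slope.
  assert (0 <= y a * s ^ 2) by (apply Rmult_le_pos; [trivial|apply pow2_ge_0]). lra. }
assert (HG : forall x, 0 < x -> G x * K x = n x).
{ intros x Hx. apply (flow_gradient k hk n dn y z v P b N U E NR UR F HU HE); lra. }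
assert (DG : forall a, 0 < a -> is_derive G a (G' a)).
{ intros a Ha. apply (is_derive_Rcomp (fun r => N r s) (fun x => X x s)).
  - apply (flow_nr _ _ _ _ _ _ _ F); [auto|lra].
  - apply (is_derive_position_label k hk n dn y z v P a s Ha). lra. }
assert (CM : forall a, continuous (fun x => M x s) a).
{ intros a. apply (continuous_stretch2 k n dn y z v P (fun x => x) (fun _ => s)); cont. }
assert (Cq : forall a, continuous (fun x => q x s) a).
{ intros a. apply (continuous_jac_num k n dn y z v P (fun x => x) (fun _ => s)); cont. }
assert (CK : forall a, continuous K a) by (intros; unfold K; cont; auto).
assert (CM' : forall a, 0 < a -> continuous M' a).
{ intros a Ha. unfold M'. cont; auto. lra. }
assert (CG' : forall a, 0 < a -> continuous G' a).
{ intros a Ha. unfold G'. cont; auto.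
  - generalize (sqrt_stretch2_ge1 k hk n dn y z v P a s). lra.
  - apply (continuous_comp_2 (fun x => X x s) (fun x => s) (fun r t => NR r t) a).
    + apply (continuous_position k n dn y z v P (fun x => x) (fun _ => s)); cont.
    + cont.
    + apply (unclamp_continuous NR); [lra|]. apply (flow_cnr _ _ _ _ _ _ _ F); [auto|lra]. }
assert (Cn := prof_cn _ _ _ _ _ P). assert (Cdn := prof_cdn _ _ _ _ _ P).
assert (Ckap : forall a, 0 < a -> continuous kap a).
{ intros a Ha. unfold kap. cont; auto. }
exists (fun x => (num' x * jac_slope x s - (n x * q x s - n x * jac_const x s) * jac_slope_a x s)
             / jac_slope x s ^ 2).
intros a Ha.
assert (Ca := continuous_id a : continuous (fun x => x) a).
assert (Cs := continuous_const s a : continuous (fun _ => s) a).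
assert (Ha0 : a <> 0) by lra.
assert (C1 := continuous_jac_const _ _ a Ca Cs).
assert (C2 := continuous_jac_slope _ _ a Ca Cs).
assert (C3 := continuous_jac_const_a _ _ a Ca Cs Ha0).
assert (C4 := continuous_jac_slope_a _ _ a Ca Cs Ha0).
split.
- unfold num'. cont; auto.
  + apply pow_nonzero. generalize (HM a); lra.
  + apply pow_nonzero. generalize (Hsl a); lra.
(* [G a * K x = n x - (G x - G a) * K x], where [K] is only continuous but the difference in front
   of it is differentiable and vanishes at [a]. *)
- assert (D1 : is_derive (fun x => G a * K x) a (dn a - G' a * K a)).
  { apply is_derive_ext_loc with (fun x => n x - (G x - G a) * K x).
    - apply filter_imp with (2 := locally_gt 0 a Ha). intros x Hx.
      req. rewrite <- (HG x Hx). ring.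
    - apply is_derive_Rminus; [now apply (prof_dn _ _ _ _ _ P)|].
      apply (is_derive_mult_vanishing (fun x => G x - G a)); [|ring|apply CK].
      evar_last; [apply is_derive_Rminus; [now apply DG|apply is_derive_cst]|]. req. ring. }
  assert (D2 : is_derive (fun x => n a * K x) a (kap a)).
  { apply is_derive_ext with (fun x => K a * (G a * K x)).
    - intros x. req. rewrite <- (HG a Ha). ring.
    - unfold kap. apply is_derive_scal. exact D1. }
  assert (D3 := is_derive_stretch2_label k n dn y z v P a s Ha).
  fold (M' a) in D3.
  assert (D4 := is_derive_jac_const a s Ha).
  assert (D5 := is_derive_jac_slope a s Ha).
  (* [n a * v x] is solved from [n a * q = n a * jac_const + n a * v * jac_slope]. *)
  apply is_derive_ext with (fun x => ((n a * K x) / M x s - n a * jac_const x s) / jac_slope x s).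
  + intros x. req. unfold K. rewrite jac_num_affine. field.
    generalize (Hsl x) (HM x). intros. split; lra.
  + evar_last.
    * apply is_derive_Rdiv; [|exact D5|apply Rgt_not_eq, Hsl].
      apply is_derive_Rminus; [|apply is_derive_Rmult; [apply is_derive_cst|exact D4]].
      apply is_derive_Rdiv; [exact D2|exact D3|generalize (HM a); lra].
    * req. unfold num', K. field.
      generalize (Hsl a) (HM a). intros. split; lra.
Qed.

(** Derivative at [x = a] of [n a * q x t]: the weight [n a] is frozen, since [q] alone may not be
    differentiable in the label. *)
Definition jac_num_wa (w : R -> R) (a t : R) : R :=
  n a * jac_const_a a t + w a * jac_slope a t + n a * v a * jac_slope_a a t.

Definition density_a (w : R -> R) (a t : R) : R :=
  (dn a * q a t - jac_num_wa w a t) / (M a t * q a t ^ 2)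
  - n a * (2 * (q a t - M a t) / a) / (M a t ^ 2 * q a t).

(** [n / q] is written as [((n x * q a - n a * q x) / q x + n a) / q a]. The inner numerator
    involves [q x] only with the weight [n a], so it is differentiable; it vanishes at [a], and its
    cofactor [/ q x] is continuous. *)
Lemma is_derive_density (w : R -> R) (a t : R) :
  0 < a -> 0 <= t -> locally a (fun x => 0 < q x t) ->
  is_derive (fun x => n a * v x) a (w a) ->
  is_derive (fun x => n x / (M x t * q x t)) a (density_a w a t).
Proof.
intros Ha Ht Hq Hw.
assert (HM : forall x, 1 <= M x t) by (intros; now apply (stretch2_ge1 k hk n dn y z v P)).
assert (Hqa := locally_singleton _ _ Hq). simpl in Hqa.
assert (Dq : is_derive (fun x => n a * q x t) a (jac_num_wa w a t)).
{ apply is_derive_ext with (fun x => n a * jac_const x t + n a * v x * jac_slope x t).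
  - intros x. req. rewrite jac_num_affine. ring.
  - assert (D4 := is_derive_jac_const a t Ha). assert (D5 := is_derive_jac_slope a t Ha).
    evar_last.
    + apply is_derive_Rplus; [apply is_derive_Rmult; [apply is_derive_cst|exact D4]|].
      apply is_derive_Rmult; [exact Hw|exact D5].
    + req. unfold jac_num_wa. ring. }
assert (Dpsi : is_derive (fun x => (n x * q a t - n a * q x t) * / q x t) a
  ((dn a * q a t - jac_num_wa w a t) * / q a t)).
{ apply (is_derive_mult_vanishing (fun x => n x * q a t - n a * q x t) (fun x => / q x t)).
  - evar_last.
    + apply is_derive_Rminus; [|exact Dq].
      apply is_derive_Rmult; [now apply (prof_dn _ _ _ _ _ P)|apply is_derive_cst].
    + req. ring.
  - ring.
  - apply continuous_Rinverse; [|lra].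
    apply (continuous_jac_num k n dn y z v P (fun x => x) (fun _ => t)); cont. }
assert (D3 := is_derive_stretch2_label k n dn y z v P a t Ha).
apply is_derive_ext_loc with
  (fun x => ((n x * q a t - n a * q x t) * / q x t + n a) / (M x t * q a t)).
- apply filter_imp with (2 := Hq). intros x Hx. generalize (HM x). intros HMx.
  req. field. repeat split; lra.
- evar_last.
  + apply is_derive_Rdiv.
    * apply is_derive_Rplus; [exact Dpsi|apply is_derive_cst].
    * apply is_derive_Rmult; [exact D3|apply is_derive_cst].
    * generalize (HM a); nra.
  + req. unfold density_a. generalize (HM a); intros HMa. field. repeat split; lra.
Qed.

Lemma continuous_density_a (w : R -> R) {U : UniformSpace} (f g : U -> R) (x : U) :
  continuous f x -> continuous g x -> 0 < f x -> 0 <= g x -> 0 < q (f x) (g x) ->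
  continuous w (f x) ->
  continuous (fun p => density_a w (f p) (g p)) x.
Proof.
intros Hf Hg Hfx Hgx Hq Hw.
assert (Hf0 : f x <> 0) by lra.
assert (HM := stretch2_ge1 k hk n dn y z v P (f x) (g x) Hgx).
assert (C1 := continuous_jac_slope f g x Hf Hg).
assert (C3 := continuous_jac_const_a f g x Hf Hg Hf0).
assert (C4 := continuous_jac_slope_a f g x Hf Hg Hf0).
assert (C5 := continuous_stretch2 k n dn y z v P f g x Hf Hg).
assert (C6 := continuous_jac_num k n dn y z v P f g x Hf Hg).
assert (C7 := continuous_comp_everywhere n f x (prof_cn _ _ _ _ _ P) Hf).
assert (C8 := continuous_comp_everywhere dn f x (prof_cdn _ _ _ _ _ P) Hf).
assert (C9 := continuous_comp_everywhere v f x (prof_cv _ _ _ _ _ P) Hf).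
assert (C10 : continuous (fun p => w (f p)) x) by now apply continuous_Rcomp.
assert (HMne : M (f x) (g x) <> 0) by lra.
assert (Hqne : q (f x) (g x) <> 0) by lra.
unfold density_a, jac_num_wa. cont; auto.
- apply Rmult_integral_contrapositive; split; [trivial|now apply pow_nonzero].
- apply Rmult_integral_contrapositive; split; [now apply pow_nonzero|trivial].
Qed.
End Regularity.

(** * Continuation *)

Lemma continuous_within2_of_continuous (D : R * R -> Prop) (f : R -> R -> R) :
  (forall r t, D (r, t) -> continuous (fun p : R * R => f (fst p) (snd p)) (r, t)) ->
  continuous_within2 D f.
Proof.
intros H [r t] Hp.
intros Q HQ.
apply filter_imp with (2 := H r t Hp Q HQ : locally (r, t) (fun p => Q (f (fst p) (snd p)))).
now intros.
Qed.

Lemma locally_upto (T t : R) : locally t (upto T) -> 0 < t < T.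
Proof.
intros [d Hd]. assert (Hd0 := cond_pos d).
assert (H1 : upto T (t - d / 2)).
{ apply Hd. change (Rabs (t - d / 2 - t) < d).
  replace (t - d / 2 - t) with (- (d / 2)) by ring.
  rewrite Rabs_Ropp, Rabs_pos_eq; lra. }
assert (H2 : upto T (t + d / 2)).
{ apply Hd. change (Rabs (t + d / 2 - t) < d).
  replace (t + d / 2 - t) with (d / 2) by ring. rewrite Rabs_pos_eq; lra. }
unfold upto in *. lra.
Qed.

(* [min T (max 0 t)], written with [Rmax 0] alone, the only lattice operation whose
   continuity is needed. *)
Definition clip (T t : R) : R := T - Rmax 0 (T - Rmax 0 t).

Lemma clip_range (T t : R) : 0 <= T -> 0 <= clip T t <= T.
Proof.
intros HT. unfold clip. generalize (Rmax_l 0 t) (Rmax_l 0 (T - Rmax 0 t)).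
intros H1 H2. split; [|lra].
assert (Rmax 0 (T - Rmax 0 t) <= T); [|lra]. apply Rmax_lub; lra.
Qed.

Lemma clip_id (T t : R) : 0 <= t <= T -> clip T t = t.
Proof. intros Ht. unfold clip. rewrite (Rmax_right 0 t), Rmax_right by lra. ring. Qed.

(** * Inversion of the flow map *)

Section Labels.
Context (k : R) (hk : 0 < k) (n dn y z v : R -> R) (P : profile n dn y z v).
Context (T : R) (hT : 0 < T).
Notation M := (stretch2 k y z).
Notation q := (jac_num k n y z v).
Notation X := (position k y z).
Context (hq : forall a t, 0 < a -> 0 <= t <= T -> 0 < q a t).

Lemma position_increasing (a a' t : R) :
  0 <= a < a' -> 0 <= t <= T -> X a t < X a' t.
Proof.
intros Ha Ht.
destruct (mean_value (fun x => X x t) (fun x => q x t / sqrt (M x t)) a a') as (c & Hc & E).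
- lra.
- intros x Hx. apply (is_derive_position_label k hk n dn y z v P); lra.
- intros x Hx. apply (continuous_position k n dn y z v P (fun x => x) (fun _ => t)); cont.
- assert (0 < q c t) by (apply hq; lra).
  assert (Hsq := sqrt_stretch2_ge1 k hk n dn y z v P c t (proj1 Ht)).
  assert (0 < q c t / sqrt (M c t)) by (apply Rdiv_lt_0_compat; lra). nra.
Qed.

(** Intermediate values between the labels 0 and [r]: the former stays at the centre, the latter has
    moved outward. It is a [sig], so the label becomes a function by projection. *)
Lemma label_exists (r t : R) :
  {a : R | 0 <= a <= Rmax 0 r /\ X a (clip T t) = Rmax 0 r}.
Proof.
assert (Ht := clip_range T t (Rlt_le _ _ hT)). assert (Hr := Rmax_l 0 r).
destruct (IVT_gen (fun a => X a (clip T t)) 0 (Rmax 0 r) (Rmax 0 r)) as (a & Ha & E).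
- intros a. apply continuous_is_pt.
  apply (continuous_position k n dn y z v P (fun x => x) (fun _ => clip T t)); cont.
- assert (E0 : X 0 (clip T t) = 0) by (unfold position; ring). rewrite E0.
  assert (H := position_ge k hk n dn y z v P (Rmax 0 r) (clip T t) Hr (proj1 Ht)).
  revert H Hr. generalize (Rmax 0 r). intros c Hc1 Hc2.
  rewrite Rmin_left, Rmax_right by lra. lra.
- exists a. revert Ha Hr E. generalize (Rmax 0 r). intros c Ha Hc E.
  rewrite Rmin_left, Rmax_right in Ha by trivial. now split.
Qed.

(** By monotonicity, [A r t < c] amounts to [X c t > r], an open condition on [(r, t)] jointly; the
    same holds with both inequalities reversed. *)
Lemma label_function : exists A : R -> R -> R,
  (forall r t, 0 <= A r t <= Rmax 0 r /\ X (A r t) (clip T t) = Rmax 0 r) /\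
  (forall p, continuous (fun p : R * R => A (fst p) (snd p)) p).
Proof.
set (A := fun r t => proj1_sig (label_exists r t)).
assert (HA : forall r t, 0 <= A r t <= Rmax 0 r /\ X (A r t) (clip T t) = Rmax 0 r).
{ intros r t. exact (proj2_sig (label_exists r t)). }
exists A. split; trivial.
intros [r t]. apply filterlim_locally. intros eps.
set (a := A r t).
assert (Ccl : forall p, continuous (fun p : R * R => clip T (snd p)) p).
{ intros p. unfold clip. cont. }
assert (Cmp : forall c, continuous (fun p : R * R => X c (clip T (snd p)) - Rmax 0 (fst p)) (r, t)).
{ intros c. cont. apply (continuous_position k n dn y z v P (fun _ => c)); [cont|apply Ccl]. }
assert (Heps := cond_pos eps).
assert (Ht : forall t, 0 <= clip T t <= T) by (intros; apply clip_range; lra).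
destruct (HA r t) as [Ha Ea]. fold a in Ha, Ea.
assert (Hup : locally (r, t) (fun p : R * R => A (fst p) (snd p) < a + eps)).
{ assert (H : 0 < X (a + eps) (clip T t) - Rmax 0 r).
  { rewrite <- Ea. generalize (position_increasing a (a + eps) (clip T t)).
    intros G; specialize (G ltac:(lra) (Ht t)). lra. }
  apply filter_imp with (2 := locally_pos _ _ (Cmp (a + eps)) H).
  intros [x t'] Hp. cbn [fst snd] in *. destruct (HA x t') as [G1 G2].
  change (0 < X (a + eps) (clip T t') - Rmax 0 x) in Hp. rewrite <- G2 in Hp.
  apply Rnot_le_lt. intros [Hle|Hle].
  - generalize (position_increasing (a + eps) (A x t') (clip T t')).
    intros G; specialize (G ltac:(lra) (Ht _)). lra.
  - rewrite <- Hle in Hp. lra. }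
assert (Hlo : locally (r, t) (fun p : R * R => a - eps < A (fst p) (snd p))).
(* Below the label 0 there is no particle to compare with, but labels are nonnegative. *)
{ destruct (Rlt_le_dec (a - eps) 0) as [Hn|Hn].
  - apply filter_forall. intros [x t']. cbn [fst snd]. destruct (HA x t') as [G1 _]. lra.
  - assert (H : 0 < - (X (a - eps) (clip T t) - Rmax 0 r)).
    { rewrite <- Ea. generalize (position_increasing (a - eps) a (clip T t)).
      intros G; specialize (G ltac:(lra) (Ht t)). lra. }
    apply filter_imp with (2 := locally_pos _ _ (continuous_Ropp _ _ (Cmp (a - eps))) H).
    intros [x t'] Hp. cbn [fst snd] in *. destruct (HA x t') as [G1 G2].
    change (0 < - (X (a - eps) (clip T t') - Rmax 0 x)) in Hp. rewrite <- G2 in Hp.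
    apply Rnot_le_lt. intros [Hle|Hle].
    + generalize (position_increasing (A x t') (a - eps) (clip T t')).
      intros G; specialize (G ltac:(lra) (Ht _)). lra.
    + rewrite <- Hle in Hp. lra. }
apply filter_imp with (2 := filter_and _ _ Hup Hlo). intros p [G1 G2].
change (Rabs (A (fst p) (snd p) - a) < eps). apply Rabs_lt_between. lra.
Qed.
End Labels.

(** * The explicit solution on the closed time interval *)

Section Extension.
Context (k : R) (hk : 0 < k) (n dn y z v : R -> R) (P : profile n dn y z v).
Context (T : R) (hT : 0 < T).
Notation M := (stretch2 k y z).
Notation q := (jac_num k n y z v).
Notation qt := (jac_num_t k n y z v).
Notation X := (position k y z).
Notation H := (hubble k y z).
Context (hq : forall a t, 0 < a -> 0 <= t <= T -> 0 < q a t).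
Context (N U E NR UR : R -> R -> R) (F : euler_flow k T N U E NR UR).
Context (hU : forall a, 0 < a -> U a 0 = a * y a)
  (hE : forall a, 0 < a -> E a 0 = a ^ 4 * z a).
Context (A : R -> R -> R)
  (hA : forall r t, 0 <= A r t <= Rmax 0 r /\ X (A r t) (clip T t) = Rmax 0 r)
  (cA : forall p, continuous (fun p : R * R => A (fst p) (snd p)) p).
Context (w : R -> R)
  (hw : forall a, 0 < a -> continuous w a /\ is_derive (fun x => n a * v x) a (w a)).

(** At the centre [v = y] and [z = n / 4], so [q] is [(1 + y t)^2 + k n t^2 / 4]. *)
Lemma jac_num_pos (a t : R) : 0 <= a -> 0 <= t <= T -> 0 < q a t.
Proof.
intros [Ha|<-] Ht; [now apply hq|].
unfold jac_num. rewrite <- (prof_y0 _ _ _ _ _ P), (prof_z0 _ _ _ _ _ P).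
assert (H1 := prof_y_ge0 _ _ _ _ _ P 0). assert (H2 := prof_n_ge0 _ _ _ _ _ P 0).
assert (0 <= y 0 * t) by (apply Rmult_le_pos; lra).
assert (0 <= y 0 * y 0) by now apply Rmult_le_pos.
assert (0 <= k * (n 0 / 2 - n 0 / 4)) by (apply Rmult_le_pos; lra).
assert (0 <= (y 0 * y 0 + k * (n 0 / 2 - n 0 / 4)) * t ^ 2).
{ apply Rmult_le_pos; [lra|apply pow2_ge_0]. }
lra.
Qed.

(** The explicit solution in Eulerian variables: density, velocity, charge, label gradient, and the
    radial derivatives of density and velocity. With [Rmax 0 r] for the position, the velocity
    visibly vanishes at the centre. *)
Let s (t : R) : R := clip T t.
Let Nx (r t : R) : R := n (A r t) / (M (A r t) (s t) * q (A r t) (s t)).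
Let Ux (r t : R) : R := Rmax 0 r * H (A r t) (s t).
Let Cx (r t : R) : R := A r t ^ 4 * z (A r t).
Let Ar (r t : R) : R := / (q (A r t) (s t) / sqrt (M (A r t) (s t))).
Let Nr (r t : R) : R := Ar r t * density_a k n dn y z v w (A r t) (s t).
Let Ur (r t : R) : R := qt (A r t) (s t) / q (A r t) (s t) - H (A r t) (s t).

Let hs (t : R) : 0 <= s t <= T.
Proof. apply clip_range; lra. Qed.

Let qA (r t : R) : 0 < q (A r t) (s t).
Proof. apply jac_num_pos; [apply hA|apply hs]. Qed.

Let MA (r t : R) : 1 <= M (A r t) (s t).
Proof. apply (stretch2_ge1 k hk n dn y z v P), hs. Qed.

Let sMA (r t : R) : 1 <= sqrt (M (A r t) (s t)).
Proof. apply (sqrt_stretch2_ge1 k hk n dn y z v P), hs. Qed.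

Let A_pos (r t : R) : 0 < r -> 0 < A r t.
Proof.
intros Hr. destruct (hA r t) as [[[Ha|Ha] _] E0]; trivial.
rewrite <- Ha, Rmax_right in E0 by lra. unfold position in E0. lra.
Qed.

Let XA (r t : R) : 0 < r -> 0 <= t <= T -> X (A r t) t = r.
Proof.
intros Hr Ht. destruct (hA r t) as [_ E0].
rewrite clip_id, Rmax_right in E0 by lra. exact E0.
Qed.

Let cs (p : R * R) : continuous (fun p : R * R => s (snd p)) p.
Proof. unfold s, clip. cont. Qed.

Let cM (p : R * R) : continuous (fun p : R * R => M (A (fst p) (snd p)) (s (snd p))) p.
Proof. apply (continuous_stretch2 k n dn y z v P (fun p : R * R => A (fst p) (snd p))); auto. Qed.

Let cq (p : R * R) : continuous (fun p : R * R => q (A (fst p) (snd p)) (s (snd p))) p.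
Proof. apply (continuous_jac_num k n dn y z v P (fun p : R * R => A (fst p) (snd p))); auto. Qed.

Let cqt (p : R * R) : continuous (fun p : R * R => qt (A (fst p) (snd p)) (s (snd p))) p.
Proof. apply (continuous_jac_num_t k n dn y z v P (fun p : R * R => A (fst p) (snd p))); auto. Qed.

Let cH (p : R * R) : continuous (fun p : R * R => H (A (fst p) (snd p)) (s (snd p))) p.
Proof.
apply (continuous_hubble k hk n dn y z v P (fun p : R * R => A (fst p) (snd p))); auto.
apply hs.
Qed.

Let cNx (p : R * R) : continuous (fun p : R * R => Nx (fst p) (snd p)) p.
Proof.
unfold Nx. apply continuous_Rdiv.
- apply (continuous_comp_everywhere n (fun p : R * R => A (fst p) (snd p))); auto. apply P.
- now apply continuous_Rmult.
- generalize (qA (fst p) (snd p)) (MA (fst p) (snd p)). nra.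
Qed.

Let cUx (p : R * R) : continuous (fun p : R * R => Ux (fst p) (snd p)) p.
Proof. unfold Ux. apply continuous_Rmult; auto. cont. Qed.

Let cCx (p : R * R) : continuous (fun p : R * R => Cx (fst p) (snd p)) p.
Proof.
unfold Cx. apply continuous_Rmult; [apply continuous_Rpow|]; auto.
apply (continuous_comp_everywhere z (fun p : R * R => A (fst p) (snd p))); auto. apply P.
Qed.

Let cNr (r t : R) : 0 < r -> continuous (fun p : R * R => Nr (fst p) (snd p)) (r, t).
Proof.
intros Hr. unfold Nr, Ar. assert (HA := A_pos r t Hr).
assert (G1 := qA r t). assert (G2 := sMA r t).
apply continuous_Rmult.
- apply continuous_Rinverse.
  + apply continuous_Rdiv; auto; [now apply continuous_Rsqrt|simpl; lra].
  + simpl. apply Rgt_not_eq, Rdiv_lt_0_compat; lra.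
- apply (continuous_density_a k hk n dn y z v P w (fun p : R * R => A (fst p) (snd p))
    (fun p : R * R => s (snd p))); auto.
  + apply hs.
  + now apply hw.
Qed.

Let cUr (p : R * R) : continuous (fun p : R * R => Ur (fst p) (snd p)) p.
Proof.
unfold Ur. apply continuous_Rminus; auto. apply continuous_Rdiv; auto.
apply Rgt_not_eq, qA.
Qed.

Let dA (r t : R) : 0 < r -> is_derive (fun x => A x t) r (Ar r t).
Proof.
intros Hr. unfold Ar.
apply (is_derive_inverse (fun a => X a (s t))).
- apply (continuous_comp_2 (fun x : R => x) (fun _ : R => t) A r); [cont|cont|apply cA].
- apply filter_imp with (2 := locally_gt 0 r Hr). intros x Hx.
  destruct (hA x t) as [_ E0]. rewrite Rmax_right in E0 by lra. exact E0.
- apply (is_derive_position_label k hk n dn y z v P); [auto|apply hs].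
- apply Rgt_not_eq, Rdiv_lt_0_compat; [apply qA|]. generalize (sMA r t); lra.
Qed.

Let dNx (r t : R) : 0 < r -> is_derive (fun x => Nx x t) r (Nr r t).
Proof.
intros Hr.
apply (is_derive_Rcomp (fun a => n a / (M a (s t) * q a (s t))) (fun x => A x t)); auto.
apply is_derive_density; auto.
- apply hs.
- apply filter_imp with (2 := locally_gt 0 (A r t) (A_pos r t Hr)). intros a Ha.
  apply hq; [trivial|apply hs].
- now apply hw, A_pos.
Qed.

Let dUx (r t : R) : 0 < r -> is_derive (fun x => Ux x t) r (Ur r t).
Proof.
intros Hr.
apply is_derive_ext with (fun x => X (A x t) (s t) * H (A x t) (s t)).
- intros x. unfold Ux. now rewrite <- (proj2 (hA x t)).
- evar_last.
  + apply (is_derive_Rcomp (fun a => X a (s t) * H a (s t)) (fun x => A x t)); [|now apply dA].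
    apply (is_derive_velocity_label k hk n dn y z v P); [auto|apply hs].
  + req. unfold Ar, Ur. generalize (qA r t) (sMA r t). intros. field. lra.
Qed.

Let dCx (r t : R) : 0 < r -> is_derive (fun x => Cx x t) r (Nx r t * r ^ 3).
Proof.
intros Hr. assert (Ha := A_pos r t Hr).
evar_last.
- apply (is_derive_Rcomp (fun a => a ^ 4 * z a) (fun x => A x t)); [|now apply dA].
  assert (H2 := prof_dz _ _ _ _ _ P _ Ha). repeat der1.
- req. unfold Ar, Nx. generalize (qA r t) (sMA r t). intros G1 G2.
  assert (E0 := proj2 (hA r t)). rewrite Rmax_right in E0 by lra. fold (s t) in E0.
  replace (r ^ 3) with ((A r t * sqrt (M (A r t) (s t))) ^ 3) by (f_equal; exact E0).
  assert (E1 := sqr_sqrt_stretch2 k hk n dn y z v P (A r t) (s t) (proj1 (hs t))).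
  revert E1 G2. generalize (sqrt (M (A r t) (s t))). intros c <- G2.
  simpl INR. field. lra.
Qed.

Let NxE (r t : R) : 0 < r -> 0 <= t < T -> N r t = Nx r t.
Proof.
intros Hr Ht. destruct (flow_gradient k hk n dn y z v P T N U E NR UR F hU hE (A r t) t
  (A_pos r t Hr) Ht) as [_ G].
rewrite XA in G by lra. generalize (qA r t) (MA r t). unfold Nx, s.
rewrite clip_id by lra. intros G1 G2. rewrite <- G. field. lra.
Qed.

Let UxE (r t : R) : 0 < r -> 0 <= t < T -> U r t = Ux r t.
Proof.
intros Hr Ht. destruct (flow_on_path k hk n dn y z v P T N U E NR UR F hU hE (A r t) t
  (A_pos r t Hr) Ht) as [G _].
rewrite XA in G by lra. unfold Ux, s. now rewrite clip_id, Rmax_right by lra.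
Qed.

Let CxE (r t : R) : 0 < r -> 0 <= t < T -> E r t = Cx r t.
Proof.
intros Hr Ht. destruct (flow_on_path k hk n dn y z v P T N U E NR UR F hU hE (A r t) t
  (A_pos r t Hr) Ht) as [_ G].
now rewrite XA in G by lra.
Qed.

Let is_derive_agree (f g : R -> R -> R) (r t l m : R) : 0 < r -> 0 <= t < T ->
  (forall x t, 0 < x -> 0 <= t < T -> f x t = g x t) ->
  is_derive (fun x => f x t) r l -> is_derive (fun x => g x t) r m -> l = m.
Proof.
intros Hr Ht Hfg Hf Hg. rewrite <- (Derive_eq _ _ _ Hf), <- (Derive_eq _ _ _ Hg).
apply Derive_ext_loc. apply filter_imp with (2 := locally_gt 0 r Hr). auto.
Qed.

Let NrE (r t : R) : 0 < r -> 0 <= t < T -> NR r t = Nr r t.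
Proof.
intros Hr Ht. apply (is_derive_agree N Nx r t); auto. now apply (flow_nr _ _ _ _ _ _ _ F).
Qed.

Let UrE (r t : R) : 0 < r -> 0 <= t < T -> UR r t = Ur r t.
Proof.
intros Hr Ht. apply (is_derive_agree U Ux r t); auto. now apply (flow_ur _ _ _ _ _ _ _ F).
Qed.

(** Time derivatives are not computed from the formulas: before [T] the fields agree with the given
    solution, which obeys the equations. At the endpoints only the continuity of these expressions
    is asked. *)
Let Nt (r t : R) : R := - (Nr r t * Ux r t + Nx r t * Ur r t + 3 * Nx r t * Ux r t / r).
Let Ut (r t : R) : R := - Ux r t * Ur r t + k * Cx r t / r ^ 3.

Let dt_agree (f g : R -> R -> R) (r t l : R) : 0 < r -> 0 < t < T ->
  (forall x t, 0 < x -> 0 <= t < T -> f x t = g x t) ->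
  is_derive (fun t => f r t) t l -> is_derive (fun t => g r t) t l.
Proof.
intros Hr Ht Hfg. apply is_derive_ext_loc.
apply filter_imp with (2 := locally_Ioo 0 T t Ht). intros t' Ht'. apply Hfg; lra.
Qed.

Let dtNx (r t : R) : 0 < r -> 0 < t < T -> is_derive (fun t => Nx r t) t (Nt r t).
Proof.
intros Hr Ht. apply (dt_agree N Nx r t); auto.
unfold Nt. rewrite <- NxE, <- UxE, <- NrE, <- UrE by lra. now apply (flow_nt _ _ _ _ _ _ _ F).
Qed.

Let dtUx (r t : R) : 0 < r -> 0 < t < T -> is_derive (fun t => Ux r t) t (Ut r t).
Proof.
intros Hr Ht. apply (dt_agree U Ux r t); auto.
unfold Ut. rewrite <- CxE, <- UxE, <- UrE by lra. now apply (flow_ut _ _ _ _ _ _ _ F).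
Qed.

(** Only [phi_r] enters the equations; the base point 1 is an arbitrary positive radius. *)
Let Phi (r t : R) : R := - RInt (fun x => Cx x t / x ^ 3) 1 r.

Let dPhi (r t : R) : 0 < r -> is_derive (fun x => Phi x t) r (- (Cx r t / r ^ 3)).
Proof.
intros Hr. unfold Phi. apply is_derive_Ropp.
assert (Hc : forall x, 0 < x -> continuous (fun x => Cx x t / x ^ 3) x).
{ intros x Hx. apply continuous_Rdiv; [|cont|apply pow_nonzero; lra].
  apply (continuous_comp_2 (fun x : R => x) (fun _ : R => t) Cx x); [cont|cont|apply cCx]. }
apply (is_derive_RInt (fun x => Cx x t / x ^ 3) (fun r => RInt (fun x => Cx x t / x ^ 3) 1 r) 1 r);
  [|now apply Hc].
apply filter_imp with (2 := locally_gt 0 r Hr). intros x Hx.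
apply (@RInt_correct R_CompleteNormedModule).
apply (@ex_RInt_continuous R_CompleteNormedModule). intros x' [Hx' _].
apply Hc. apply Rlt_le_trans with (2 := Hx'). apply Rmin_glb_lt; lra.
Qed.

Lemma extended_solution (n0 u0 : R -> R) :
  (forall r, 0 < r -> N r 0 = n0 r /\ U r 0 = u0 r) ->
  exists n' u' phi', classical_solution k n0 u0 (upto T) n' u' phi' /\
    forall r t, 0 < r -> 0 <= t < T -> n' r t = N r t /\ u' r t = U r t.
Proof.
intros Hinit. exists Nx, Ux, Phi.
assert (DPhi : forall r t, 0 < r -> Derive (fun x => Phi x t) r = - (Cx r t / r ^ 3)).
{ intros r t Hr. now apply Derive_eq, dPhi. }
split.
- constructor.
  + split; [apply continuous_within2_of_continuous; intros; apply cNx|].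
    exists Nr, Nt. split; [|split; [|split]].
    * apply continuous_within2_of_continuous. intros r t [Hr _]. now apply cNr.
    * apply continuous_within2_of_continuous. intros r t [Hr _]. simpl in Hr.
      assert (G := cNr r t Hr). unfold Nt. cont; auto. lra.
    * intros r t Hr _. now apply dNx.
    * intros r t Hr Ht. apply dtNx; [trivial|now apply locally_upto].
  + split; [apply continuous_within2_of_continuous; intros; apply cUx|].
    exists Ur, Ut. split; [|split; [|split]].
    * apply continuous_within2_of_continuous. intros; apply cUr.
    * apply continuous_within2_of_continuous. intros r t [Hr _]. simpl in Hr.
      unfold Ut. cont; auto. apply pow_nonzero; lra.
    * intros r t Hr _. now apply dUx.
    * intros r t Hr Ht. apply dtUx; [trivial|now apply locally_upto].
  + intros r t Hr Ht. apply locally_upto in Ht.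
    assert (H1 := dNx r t Hr). assert (H2 := dUx r t Hr).
    assert (H4 : is_derive (fun x => Nx x t * Ux x t * x ^ 3) r
      ((Nr r t * Ux r t + Nx r t * Ur r t) * r ^ 3 + Nx r t * Ux r t * (3 * r ^ 2))).
    { der. simpl INR. ring. }
    rewrite (Derive_eq (fun x : R => Nx x t * Ux x t * x ^ 3) _ _ H4),
      (Derive_eq (fun t : R => Nx r t) _ _ (dtNx r t Hr Ht)).
    unfold Nt. field. lra.
  + intros r t Hr Ht. apply locally_upto in Ht.
    rewrite (Derive_eq (fun x : R => Ux x t) _ _ (dUx r t Hr)),
      (Derive_eq (fun t : R => Ux r t) _ _ (dtUx r t Hr Ht)), DPhi by trivial.
    unfold Ut. field. lra.
  + intros r t Hr _. eexists. now apply dPhi.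
  + intros r t Hr _. apply is_derive_ext_loc with (fun x => - Cx x t).
    * apply filter_imp with (2 := locally_gt 0 r Hr). intros x Hx.
      req. rewrite DPhi by trivial. field. lra.
    * evar_last; [apply is_derive_Ropp; now apply dCx|]. req. ring.
  + intros t _. apply filterlim_ext_loc with (fun x => - Cx x t).
    * exists (mkposreal 1 Rlt_0_1). intros x _ Hx. rewrite DPhi by trivial. field. lra.
    * assert (A0 : A 0 t = 0).
      { destruct (hA 0 t) as [G _]. rewrite Rmax_left in G; lra. }
      assert (G : continuous (fun x => - Cx x t) 0).
      { apply continuous_Ropp.
        apply (continuous_comp_2 (fun x : R => x) (fun _ : R => t) Cx 0); [cont|cont|apply cCx]. }
      assert (E0 : - Cx 0 t = 0) by (unfold Cx; rewrite A0; ring).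
      unfold continuous in G. rewrite E0 in G.
      intros Q HQ.
      apply filter_imp with (2 := G Q HQ : locally 0 (fun x => Q (- Cx x t))). now intros.
  + apply continuous_within2_of_continuous; intros; apply cNx.
  + apply continuous_within2_of_continuous; intros; apply cUx.
  + intros t _. unfold Ux. rewrite Rmax_left; lra.
  + intros r Hr. rewrite <- NxE, <- UxE by lra. now apply Hinit.
- intros r t Hr Ht. rewrite NxE, UxE; auto.
Qed.
End Extension.

(** * Blow-up *)

(** With [s = 2 / t] the equation becomes [s^2 + 2 B s + 4 C = 0], which also covers the degenerate
    case [C = 0]. *)
Lemma quadratic_root (B C s : R) :
  0 <= B ^ 2 - 4 * C -> s = - B + sqrt (B ^ 2 - 4 * C) -> 0 < s ->
  1 + B * (2 / s) + C * (2 / s) ^ 2 = 0.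
Proof.
intros Hd Hs Hpos. assert (E := pow2_sqrt _ Hd).
replace (sqrt (B ^ 2 - 4 * C)) with (s + B) in E by lra.
replace C with (((s + B) ^ 2 - B ^ 2) / -4) at 1 by (rewrite E; field).
field. lra.
Qed.

(** [2 / T] solves [s^2 + 2 B s + 4 C = 0]; were it the smaller solution, the larger one [s'] would
    give a zero [2 / s'] before [T]. *)
Lemma first_root (B C T : R) :
  0 < T -> 1 + B * T + C * T ^ 2 = 0 ->
  (forall t, 0 <= t < T -> 0 < 1 + B * t + C * t ^ 2) ->
  0 <= B ^ 2 - 4 * C /\ - B + sqrt (B ^ 2 - 4 * C) = 2 / T.
Proof.
intros HT Hroot Hpos. set (s := 2 / T).
assert (Hs : 0 < s) by (apply Rdiv_lt_0_compat; lra).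
assert (ET : T = 2 / s) by (unfold s; field; lra).
assert (E : B ^ 2 - 4 * C = (s + B) ^ 2).
{ rewrite ET in Hroot.
  assert (s ^ 2 + 2 * B * s + 4 * C = 0); [|lra].
  replace (s ^ 2 + 2 * B * s + 4 * C) with (s ^ 2 * (1 + B * (2 / s) + C * (2 / s) ^ 2))
    by (field; lra).
  rewrite Hroot. ring. }
assert (Hd : 0 <= B ^ 2 - 4 * C) by (rewrite E; apply pow2_ge_0).
split; trivial.
destruct (Rle_lt_dec 0 (s + B)) as [H|H].
- rewrite E, <- Rsqr_pow2, sqrt_Rsqr by trivial. ring.
- exfalso.
  assert (E2 : sqrt (B ^ 2 - 4 * C) = - (s + B)).
  { rewrite E. replace ((s + B) ^ 2) with (Rsqr (- (s + B))) by (unfold Rsqr; ring).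
    apply sqrt_Rsqr. lra. }
  assert (Hs' : 0 < - B + sqrt (B ^ 2 - 4 * C)) by lra.
  assert (Hr := quadratic_root B C _ Hd eq_refl Hs').
  set (s' := - B + sqrt (B ^ 2 - 4 * C)) in *.
  assert (Hlt : 2 / s' < T).
  { rewrite ET. unfold Rdiv. apply Rmult_lt_compat_l; [lra|].
    apply Rinv_lt_contravar; [now apply Rmult_lt_0_compat|]. unfold s'. lra. }
  assert (0 < 2 / s') by (apply Rdiv_lt_0_compat; lra).
  specialize (Hpos (2 / s')). lra.
Qed.

Lemma left_of_locally (T : R) (Q : R -> Prop) : locally T Q -> at_left T Q.
Proof. intros HQ. apply filter_imp with (2 := HQ). now intros. Qed.

Lemma at_left_interval (T : R) : 0 < T -> at_left T (fun t => 0 <= t < T).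
Proof.
intros HT. apply filter_imp with (2 := locally_gt 0 T HT). intros t Ht Ht'. lra.
Qed.

Lemma filterlim_p_infty (F : (R -> Prop) -> Prop) {FF : Filter F} (f : R -> R) :
  (forall m, F (fun t => m < f t)) -> filterlim f F (Rbar_locally p_infty).
Proof.
intros Hf Q [m Hm]. apply filter_imp with (2 := Hf m). intros t Ht. now apply Hm.
Qed.

Lemma unbounded_of_filterlim (T : R) (f : R -> R) :
  0 < T -> filterlim (fun t => Rabs (f t)) (at_left T) (Rbar_locally p_infty) ->
  unbounded_before T f.
Proof.
intros HT Hf m.
destruct (filter_and _ _ (at_left_interval T HT) (Hf (fun s => m < s) (ex_intro _ m (fun _ H => H))))
  as [d Hd].
assert (Hd0 := cond_pos d).
destruct (Hd (T - d / 2)) as [H1 H2].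
- change (Rabs (T - d / 2 - T) < d). replace (T - d / 2 - T) with (- (d / 2)) by ring.
  rewrite Rabs_Ropp, Rabs_pos_eq; lra.
- lra.
- now exists (T - d / 2).
Qed.

(** [sol_init] ties [u0] to [u] for [r > 0]; both are continuous up to the centre, so [u 0 0 = 0]
    passes to [u0]. *)
Lemma velocity_vanishes_at_centre (k b : R) (n0 u0 : R -> R) (n u phi : R -> R -> R) :
  0 < b -> C1_half_line u0 -> classical_solution k n0 u0 (before b) n u phi -> u0 0 = 0.
Proof.
intros Hb [Cu0 _] S.
set (g := fun x => u0 (Rmax 0 x) - u (Rmax 0 x) (Rmax 0 0)).
assert (Cg : continuous g 0).
{ apply continuous_Rminus; [now apply continuous_within_clamp|].
  apply (continuous_comp_2 (fun x : R => x) (fun _ : R => 0)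
    (fun x t => u (Rmax 0 x) (Rmax 0 t)) 0); [cont|cont|].
  apply clamped_continuous_centre with b; trivial. apply S. }
assert (Hg : forall x, 0 < x -> g x = 0).
{ intros x Hx. unfold g. rewrite !Rmax_right by lra.
  destruct (sol_init _ _ _ _ _ _ _ S x Hx) as [_ E]. lra. }
assert (E : g 0 = 0).
{ apply Rle_antisym.
  - assert (0 <= - g 0); [|lra]. apply (nonneg_at_0 (fun x => - g x)).
    + now apply continuous_Ropp.
    + intros x Hx. rewrite Hg; lra.
  - apply nonneg_at_0; trivial. intros x Hx. rewrite Hg; lra. }
unfold g in E. rewrite !Rmax_left in E by lra.
rewrite (sol_centre_u0 _ _ _ _ _ _ _ S) in E; [lra|]. split; simpl; lra.
Qed.

(** * Constraints of the initial data on the lifespan *)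

Section Maximal.
Context (k : R) (hk : 0 < k) (n0 u0 : R -> R) (T : Rbar) (N U phi : R -> R -> R).
Context (hT : Rbar_lt 0 T) (S : classical_solution k n0 u0 (before T) N U phi).
Context (n dn y z v : R -> R) (P : profile n dn y z v)
  (D : forall a, 0 < a -> n a = n0 a /\ v a = Derive u0 a /\ y a = u0 a / a /\ z a = E0 n0 a / a).
Notation M := (stretch2 k y z).
Notation q := (jac_num k n y z v).
Notation qt := (jac_num_t k n y z v).
Notation X := (position k y z).
Notation H := (hubble k y z).

(** The charge at time 0 and [a^4 z] have the same radial derivative [n0 a^3] and both vanish at the
    centre. A real bound [b] also accommodates an infinite lifespan. *)
Lemma flow_exists (b : R) : 0 < b -> (forall t, t < b -> Rbar_lt t T) ->
  exists E NR UR, euler_flow k b N U E NR UR /\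
    (forall a, 0 < a -> U a 0 = a * y a) /\ (forall a, 0 < a -> E a 0 = a ^ 4 * z a).
Proof.
intros Hb HbT.
assert (Sb : classical_solution k n0 u0 (before b) N U phi).
{ apply classical_solution_restrict with (2 := S).
  intros t [H1 H2]. split; trivial. now apply HbT. }
destruct (euler_flow_of_solution k b n0 u0 N U phi Hb Sb) as (NR & UR & F).
set (E := fun r t => - (r ^ 3 * Derive (fun x => phi x t) r)) in *.
exists E, NR, UR. split; [trivial|split].
- intros a Ha. destruct (sol_init _ _ _ _ _ _ _ S a Ha) as [_ ->].
  destruct (D a Ha) as (_ & _ & -> & _). field. lra.
- intros a Ha. apply Rminus_diag_uniq.
  apply (zero_of_derive_0 (fun x => E x 0 - x ^ 4 * z x)); trivial.
  + intros x Hx. assert (H1 := flow_er _ _ _ _ _ _ _ F x 0 Hx ltac:(lra)).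
    assert (H2 := prof_dz _ _ _ _ _ P x Hx).
    destruct (sol_init _ _ _ _ _ _ _ S x Hx) as [E1 _].
    destruct (D x Hx) as (E2 & _). rewrite E1, <- E2 in H1.
    der. simpl INR. field. lra.
  + assert (G : filterlim (fun x => E x 0 - x ^ 4 * z x) (at_right 0)
      (locally (0 - 0 - 0 ^ 4 * z 0))).
    { apply (filterlim_Rminus (at_right 0)).
      - apply filterlim_ext with (fun r => 0 - r ^ 3 * Derive (fun x => phi x 0) r).
        + intros r. unfold E. ring.
        + apply (filterlim_Rminus (at_right 0)); [apply filterlim_const|].
          apply (sol_centre_phi _ _ _ _ _ _ _ S). split; [lra|trivial].
      - assert (G : continuous (fun x => x ^ 4 * z x) 0) by (cont; apply P).
        intros Q HQ.
        apply filter_imp with (2 := G Q HQ : locally 0 (fun x => Q (x ^ 4 * z x))). now intros. }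
    replace (0 - 0 - 0 ^ 4 * z 0) with 0 in G by ring. exact G.
Qed.

Lemma jac_pos_before (a t : R) : 0 < a -> 0 <= t -> Rbar_lt t T -> 0 < q a t.
Proof.
intros Ha Ht HtT.
assert (Hb : exists b : R, t < b /\ forall s : R, s < b -> Rbar_lt s T).
{ destruct T as [T'| |]; simpl in *; try tauto.
  - now exists T'.
  - exists (t + 1). split; [lra|auto]. }
destruct Hb as (b & Hb1 & Hb2).
destruct (flow_exists b ltac:(lra) Hb2) as (E & NR & UR & F & HU & HE).
apply (flow_jac_pos k hk n dn y z v P b N U E NR UR F HU HE a t Ha). lra.
Qed.

(** The difference of the two sides in [admissible] is [a^2] times the discriminant of [q] as a
    quadratic in [t]. *)
Lemma admissible_iff (a : R) : 0 < a ->
  (admissible k n0 u0 a <->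
   0 <= (y a + v a) ^ 2 - 4 * (y a * v a + k * (n a / 2 - z a))) /\
  rate k n0 u0 a =
    - (y a + v a) + sqrt ((y a + v a) ^ 2 - 4 * (y a * v a + k * (n a / 2 - z a))).
Proof.
intros Ha. destruct (D a Ha) as (D1 & D2 & D3 & D4).
set (d := (y a + v a) ^ 2 - 4 * (y a * v a + k * (n a / 2 - z a))).
assert (E : (a * Derive u0 a - u0 a) ^ 2 - 4 * k * a * (n0 a * a / 2 - E0 n0 a) = a ^ 2 * d).
{ unfold d. rewrite D1, D2, D3, D4. field. lra. }
assert (Ha2 : 0 < a ^ 2) by now apply pow_lt.
split.
- unfold admissible. split.
  + intros [_ G]. apply Rmult_le_reg_l with (a ^ 2); trivial. lra.
  + intros G. split; trivial. apply Rle_ge, Rminus_le_0. rewrite E.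
    apply Rmult_le_pos; lra.
- unfold rate. rewrite E, sqrt_mult_alt by lra. rewrite sqrt_pow2 by lra.
  rewrite D2, D3. field. lra.
Qed.

Lemma rate_root (a : R) : 0 < rate k n0 u0 a -> admissible k n0 u0 a ->
  q a (2 / rate k n0 u0 a) = 0.
Proof.
intros Hr Had. assert (Ha := proj1 Had).
destruct (admissible_iff a Ha) as [G1 G2]. unfold jac_num.
apply quadratic_root; trivial. now apply G1.
Qed.

(** A larger rate would put a zero of [q] before time [b], while the solution still exists. *)
Lemma rate_le (a b : R) : 0 < b -> (forall t, t < b -> Rbar_lt t T) ->
  admissible k n0 u0 a -> rate k n0 u0 a <= 2 / b.
Proof.
intros Hb HbT Had. apply Rnot_lt_le. intros Hlt.
assert (Hb2 : 0 < 2 / b) by (apply Rdiv_lt_0_compat; lra).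
assert (Hr : 0 < rate k n0 u0 a) by lra.
assert (Hq := rate_root a Hr Had).
assert (0 < 2 / rate k n0 u0 a) by (apply Rdiv_lt_0_compat; lra).
assert (0 < q a (2 / rate k n0 u0 a)); [|lra].
apply jac_pos_before; [apply Had|lra|]. apply HbT.
apply Rmult_lt_reg_r with (rate k n0 u0 a / b).
- now apply Rdiv_lt_0_compat.
- replace (2 / rate k n0 u0 a * (rate k n0 u0 a / b)) with (2 / b) by (field; lra).
  replace (b * (rate k n0 u0 a / b)) with (rate k n0 u0 a) by (field; lra). exact Hlt.
Qed.
End Maximal.

(** * Solutions of finite lifespan *)

Section Finite_lifespan.
Context (k : R) (hk : 0 < k) (n0 u0 : R -> R) (T : R) (N U phi : R -> R -> R).
Context (hsol : maximal_solution k n0 u0 T N U phi).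
Context (n dn y z v : R -> R) (P : profile n dn y z v)
  (D : forall a, 0 < a -> n a = n0 a /\ v a = Derive u0 a /\ y a = u0 a / a /\ z a = E0 n0 a / a).
Notation M := (stretch2 k y z).
Notation q := (jac_num k n y z v).
Notation qt := (jac_num_t k n y z v).
Notation X := (position k y z).
Notation H := (hubble k y z).

Let hT : 0 < T.
Proof. exact (proj1 hsol). Qed.

Let S : classical_solution k n0 u0 (before T) N U phi.
Proof. apply hsol. Qed.

Let q_pos (a t : R) : 0 < a -> 0 <= t < T -> 0 < q a t.
Proof.
intros Ha Ht. apply (jac_pos_before k hk n0 u0 T N U phi hT S n dn y z v P D); trivial; apply Ht.
Qed.

(** Otherwise [q > 0] on [[0, T]] at every label, and the explicit formulas continue the solution to
    [T], against maximality. *)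
Lemma crossing_label : exists a, 0 < a /\ q a T = 0.
Proof.
apply NNPP. intros Hno.
assert (Hq : forall a t, 0 < a -> 0 <= t <= T -> 0 < q a t).
{ intros a t Ha [Ht [Ht'|Ht']]; [now apply q_pos|]. subst t.
  destruct (Rtotal_order (q a T) 0) as [Hl|[Hl|Hl]]; trivial; exfalso.
  (* A negative value at [T] would by continuity make [q] negative slightly earlier. *)
  - assert (Cq : continuous (fun t => - q a t) T).
    { apply continuous_Ropp. apply (continuous_jac_num k n dn y z v P (fun _ => a) (fun t => t)); cont. }
    destruct (filter_and _ _ (at_left_interval T hT)
      (left_of_locally T _ (locally_pos (fun t => - q a t) T Cq ltac:(lra)))) as [d Hd].
    assert (Hd0 := cond_pos d).
    destruct (Hd (T - d / 2)) as [H1 H2]; [|lra|].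
    + change (Rabs (T - d / 2 - T) < d). replace (T - d / 2 - T) with (- (d / 2)) by ring.
      rewrite Rabs_Ropp, Rabs_pos_eq; lra.
    + assert (G := q_pos a (T - d / 2) Ha H1). lra.
  - apply Hno. now exists a. }
destruct (flow_exists k n0 u0 T N U phi hT S n dn y z v P D T hT (fun t Ht => Ht))
  as (E & NR & UR & F & HU & HE).
destruct (label_function k hk n dn y z v P T hT Hq) as (A & HA & CA).
(* [T / 2] stands for any time strictly between 0 and [T]. *)
destruct (weighted_second_derivative k hk n dn y z v P T N U E NR UR (T / 2) F hT HU HE ltac:(lra))
  as (w & Hw).
destruct (extended_solution k hk n dn y z v P T hT Hq N U E NR UR F HU HE A HA CA w Hw n0 u0)
  as (n' & u' & phi' & Hext).
{ apply (sol_init _ _ _ _ _ _ _ S). }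
destruct hsol as (_ & _ & Hmax). apply (Hmax T eq_refl).
now exists n', u', phi'.
Qed.

Lemma crossing_rate (a : R) : 0 < a -> q a T = 0 ->
  admissible k n0 u0 a /\ rate k n0 u0 a = 2 / T.
Proof.
intros Ha Hq.
destruct (admissible_iff k n0 u0 n y z v D a Ha) as [G1 G2].
destruct (first_root (y a + v a) (y a * v a + k * (n a / 2 - z a)) T hT Hq) as [G3 G4].
- intros t Ht. now apply q_pos.
- split; [now apply G1|]. now rewrite G2.
Qed.

(** Divided by [q], [flow_gradient] reads [U_r = q_t / q - H] and [N = n0 / (M q)], and [q] tends to
    0 at [T]. *)
Lemma crossing_blowup (a : R) : 0 < a -> q a T = 0 ->
  particle_path U T a (X a) /\
  filterlim (fun t => Rabs (Derive (fun r => U r t) (X a t))) (at_left T)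
    (Rbar_locally p_infty) /\
  (0 < n0 a -> filterlim (fun t => N (X a t) t) (at_left T) (Rbar_locally p_infty)).
Proof.
intros Ha HqT.
destruct (flow_exists k n0 u0 T N U phi hT S n dn y z v P D T hT (fun t Ht => Ht))
  as (E & NR & UR & F & HU & HE).
assert (HX : forall t, 0 <= t -> 0 < X a t).
{ intros t Ht. generalize (position_ge k hk n dn y z v P a t). lra. }
split; [|split].
- split; [apply position_init|split; [|split]].
  + intros t _ Q HQ.
    assert (G : continuous (X a) t).
    { apply (continuous_position k n dn y z v P (fun _ => a) (fun t => t)); cont. }
    apply filter_imp with (2 := G Q HQ : locally t (fun t => Q (X a t))). now intros.
  + intros t [Ht _]. now apply HX.
  + intros t Ht HtT. simpl in HtT.
    destruct (flow_on_path k hk n dn y z v P T N U E NR UR F HU HE a t Ha) as [-> _]; [lra|].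
    apply (is_derive_position k hk n dn y z v P). lra.
- set (B := y a + v a). set (C := y a * v a + k * (n a / 2 - z a)).
  (* [q = (T - t) l] with [l = 1/T - C t], so [- q_t/q = 1/(T - t) + C/l]. *)
  assert (EB : B = - (1 / T) - C * T).
  { assert (E1 : 1 + B * T + C * T ^ 2 = 0) by exact HqT.
    apply Rmult_eq_reg_r with T; [|lra]. field_simplify; lra. }
  apply filterlim_p_infty; [apply at_left_proper_filter|]. intros m.
  (* In [- U_r = / (T - t) + C / l + H], the second term is at least [- Rabs C * T] and the third is
     nonnegative, so [/ (T - t) > K] forces [- U_r > m]. *)
  set (K := Rabs m + Rabs C * T + 1).
  assert (HK : 0 < K).
  { unfold K. generalize (Rabs_pos m) (Rabs_pos C). intros.
    assert (0 <= Rabs C * T) by (apply Rmult_le_pos; lra). lra. }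
  assert (HK' : 0 < / K) by now apply Rinv_0_lt_compat.
  assert (Hnear : locally T (fun t => T - / K < t)) by (apply locally_gt; lra).
  apply filter_imp with (2 := filter_and _ _ (at_left_interval T hT) (left_of_locally T _ Hnear)).
  intros t [Ht HtK].
  rewrite (Derive_eq (fun r => U r t) (X a t) (UR (X a t) t)).
  2: { apply (flow_ur _ _ _ _ _ _ _ F); trivial. now apply HX. }
  destruct (flow_gradient k hk n dn y z v P T N U E NR UR F HU HE a t Ha Ht) as [G _].
  assert (Hq := q_pos a t Ha Ht).
  assert (HM := stretch2_ge1 k hk n dn y z v P a t (proj1 Ht)).
  assert (HH : 0 <= H a t).
  { unfold hubble. apply Rdiv_le_0_compat; [|lra]. unfold stretch2_t.
    assert (Y := prof_y_ge0 _ _ _ _ _ P a). assert (Z := prof_z_ge0 _ _ _ _ _ P a).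
    assert (0 <= y a * t) by (apply Rmult_le_pos; lra).
    assert (0 <= k * z a * t) by (repeat apply Rmult_le_pos; lra).
    assert (0 <= y a * (1 + y a * t)) by (apply Rmult_le_pos; lra). lra. }
  set (l := 1 / T - C * t).
  assert (El : q a t = (T - t) * l).
  { transitivity (1 + B * t + C * t ^ 2); [reflexivity|].
    rewrite EB. unfold l. field. lra. }
  assert (Elt : qt a t = - l - (T - t) * C).
  { transitivity (B + 2 * C * t); [reflexivity|]. rewrite EB. unfold l. ring. }
  assert (Hl : 0 < l).
  { apply Rmult_lt_reg_l with (T - t); [lra|]. rewrite <- El. lra. }
  assert (EU : - UR (X a t) t = / (T - t) + C / l + H a t).
  { apply Rmult_eq_reg_r with (q a t); [|lra].
    replace (- UR (X a t) t * q a t) with (- (UR (X a t) t * q a t)) by ring.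
    rewrite G, Elt, El. field. lra. }
  (* At a double root [l] vanishes at [T] too, but then [C > 0] and the quotient has the good sign;
     for [C < 0], [l >= / T]. *)
  assert (HC : - (Rabs C * T) <= C / l).
  { destruct (Rle_lt_dec 0 C) as [H0|H0].
    - assert (0 <= C / l) by (apply Rdiv_le_0_compat; lra).
      assert (0 <= Rabs C * T) by (apply Rmult_le_pos; [apply Rabs_pos|lra]). lra.
    - rewrite Rabs_left by trivial.
      assert (Hl2 : / T <= l).
      { unfold l. replace (1 / T) with (/ T) by (field; lra).
        assert (0 <= (- C) * t) by (apply Rmult_le_pos; lra). lra. }
      assert (Hl3 : / l <= T).
      { rewrite <- (Rinv_inv T). apply Rinv_le_contravar; trivial.
        apply Rinv_0_lt_compat. lra. }
      unfold Rdiv. nra. }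
  assert (HinvK : K < / (T - t)).
  { rewrite <- (Rinv_inv K). apply Rinv_lt_contravar; [|lra].
    apply Rmult_lt_0_compat; lra. }
  apply Rlt_le_trans with (- UR (X a t) t).
  + rewrite EU. generalize (Rle_abs m). unfold K in HinvK. lra.
  + rewrite <- Rabs_Ropp. apply Rle_abs.
- intros Hn0. assert (Hn : 0 < n a) by now rewrite (proj1 (D a Ha)).
  apply filterlim_p_infty; [apply at_left_proper_filter|]. intros m.
  set (K := Rabs m + 1).
  assert (HK : 0 < K) by (unfold K; generalize (Rabs_pos m); lra).
  (* [N > K] amounts to [M q < n a / K], which holds at [T], where [q = 0], and hence nearby. *)
  assert (Cq : continuous (fun t => n a / K - M a t * q a t) T).
  { apply continuous_Rminus; [cont|apply continuous_Rmult].
    - apply (continuous_stretch2 k n dn y z v P (fun _ => a) (fun t => t)); cont.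
    - apply (continuous_jac_num k n dn y z v P (fun _ => a) (fun t => t)); cont. }
  assert (Hpos : 0 < n a / K - M a T * q a T).
  { rewrite HqT, Rmult_0_r, Rminus_0_r. now apply Rdiv_lt_0_compat. }
  apply filter_imp with (2 := filter_and _ _ (at_left_interval T hT)
    (left_of_locally T _ (locally_pos _ _ Cq Hpos))).
  intros t [Ht Hlt]. cbv beta in Hlt.
  destruct (flow_gradient k hk n dn y z v P T N U E NR UR F HU HE a t Ha Ht) as [_ G].
  assert (Hq := q_pos a t Ha Ht).
  assert (HM := stretch2_ge1 k hk n dn y z v P a t (proj1 Ht)).
  assert (HMq : 0 < M a t * q a t) by (apply Rmult_lt_0_compat; lra).
  apply Rlt_trans with K; [unfold K; generalize (Rle_abs m); lra|].
  apply Rmult_lt_reg_r with (M a t * q a t); trivial. rewrite G.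
  apply Rmult_lt_reg_l with (/ K); [now apply Rinv_0_lt_compat|].
  replace (/ K * (K * (M a t * q a t))) with (M a t * q a t) by (field; lra).
  unfold Rdiv in Hlt. lra.
Qed.
End Finite_lifespan.

Theorem corollary5p11 (k : R) (hk : 0 < k) (n0 u0 : R -> R)
    (hn0 : C1_half_line n0) (hu0 : C1_half_line u0)
    (n0_ge0 : forall r, 0 < r -> 0 <= n0 r)
    (u0_gt0 : forall r, 0 < r -> 0 < u0 r)
    (T : Rbar) (n u phi : R -> R -> R)
    (hsol : maximal_solution k n0 u0 T n u phi) :
  (blows_up n0 T n u <-> supercritical k n0 u0) /\
  (supercritical k n0 u0 ->
   exists S : R, is_lub (rates k n0 u0) S /\ 0 < S /\
     let tc := 2 / S in
     T = Finite tc /\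
     exists (alpha : R) (x : R -> R),
       0 < alpha /\ particle_path u T alpha x /\
       filterlim (fun t => Rabs (Derive (fun r => u r t) (x t)))
         (at_left tc) (Rbar_locally p_infty) /\
       (0 < n0 alpha ->
        filterlim (fun t => n (x t) t) (at_left tc) (Rbar_locally p_infty))).
Proof.
destruct (hsol) as (hT & S & _).
assert (Hb : exists b : R, 0 < b /\ forall t : R, t < b -> Rbar_lt t T).
{ destruct T as [T'| |]; simpl in *; try tauto.
  - now exists T'.
  - exists 1. split; [lra|auto]. }
destruct Hb as (b & Hb & HbT).
assert (Hu00 : u0 0 = 0).
{ apply (velocity_vanishes_at_centre k b n0 u0 n u phi Hb hu0).
  apply classical_solution_restrict with (2 := S).
  intros t [H1 H2]. split; trivial. now apply HbT. }
destruct (profile_of_data n0 u0 hn0 hu0 n0_ge0 u0_gt0 Hu00) as (m & dm & y & z & v & P & D).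
assert (Hfin : supercritical k n0 u0 -> exists T' : R, T = Finite T').
(* A positive rate gives a zero of [q] at a finite time, whereas a global solution would keep [q]
   positive. *)
{ intros (a & Had & Hr).
  assert (Hroot := rate_root k n0 u0 m y z v D a Hr Had).
  destruct T as [T'| |]; simpl in hT; [now exists T'| |tauto].
  exfalso.
  assert (0 < 2 / rate k n0 u0 a) by (apply Rdiv_lt_0_compat; lra).
  assert (G := jac_pos_before k hk n0 u0 p_infty n u phi hT S m dm y z v P D a
    (2 / rate k n0 u0 a) (proj1 Had) ltac:(lra) I). lra. }
assert (Hmain : supercritical k n0 u0 ->
   exists S : R, is_lub (rates k n0 u0) S /\ 0 < S /\
     let tc := 2 / S in
     T = Finite tc /\
     exists (alpha : R) (x : R -> R),
       0 < alpha /\ particle_path u T alpha x /\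
       filterlim (fun t => Rabs (Derive (fun r => u r t) (x t)))
         (at_left tc) (Rbar_locally p_infty) /\
       (0 < n0 alpha ->
        filterlim (fun t => n (x t) t) (at_left tc) (Rbar_locally p_infty))).
{ intros Hsup. destruct (Hfin Hsup) as [T' ET]. subst T. simpl in hT.
  destruct (crossing_label k hk n0 u0 T' n u phi hsol m dm y z v P D) as (a & Ha & Hq).
  destruct (crossing_rate k hk n0 u0 T' n u phi hsol m dm y z v P D a Ha Hq) as [Had Hrate].
  assert (E : 2 / (2 / T') = T') by (field; lra).
  (* The crossing label attains the rate [2 / T'], and [rate_le] shows that no label exceeds it. *)
  exists (2 / T'). split; [|split].
  - split.
    + intros s (a' & Had' & ->).
      apply (rate_le k hk n0 u0 T' n u phi hT S m dm y z v P D a' T' hT (fun t Ht => Ht) Had').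
    + intros s Hs. apply Hs. exists a. now split.
  - apply Rdiv_lt_0_compat; lra.
  - simpl. rewrite E. split; trivial. exists a, (position k y z a).
    split; trivial.
    apply (crossing_blowup k hk n0 u0 T' n u phi hsol m dm y z v P D a Ha Hq). }
split; [|exact Hmain]. split.
- intros (tc & ET & _). subst T. simpl in hT.
  destruct (crossing_label k hk n0 u0 tc n u phi hsol m dm y z v P D) as (a & Ha & Hq).
  destruct (crossing_rate k hk n0 u0 tc n u phi hsol m dm y z v P D a Ha Hq) as [Had Hrate].
  exists a. split; trivial. rewrite Hrate. apply Rdiv_lt_0_compat; lra.
- intros Hsup. destruct (Hmain Hsup) as (s & _ & Hs & ET & a & x & Ha & Hx & Hu & Hn).
  assert (0 < 2 / s) by (apply Rdiv_lt_0_compat; lra).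
  exists (2 / s). split; trivial. exists a, x. split; [trivial|split; [trivial|split]].
  + now apply unbounded_of_filterlim.
  + intros Hn0. apply unbounded_of_filterlim; trivial.
    intros Q [c Hc].
    apply filter_imp with (2 := Hn Hn0 _ (ex_intro _ c (fun _ G => G))
      : at_left (2 / s) (fun t => c < n (x t) t)).
    intros t Ht. apply Hc. apply Rlt_le_trans with (1 := Ht). apply Rle_abs.
Qed.
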